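(* Let $s\colon\omega_1\to\{\uparrow,\downarrow\}$ be any map, and let $M_{\omega_1,s}$ be the associated surface and $\mathbb{P}=\mathbb{P}_{\omega_1,s}$ the associated partially ordered set. Then there is a natural bijection $$[M_{\omega_1,s},\mathsf{R}]\;\simeq\;\{W\subset\mathbb{P}\,:\,W\text{ is adapted}\},$$ namely the one sending the homotopy class of a continuous map $f\colon M_{\omega_1,s}\to\mathsf{R}$ to the set $\mathfrak{C}(f)=\{\gamma<\omega_1\,:\,f|_{\Delta_\gamma}\text{ is unbounded}\}$.
   Context: $[X,Y]$ denotes the set of (free) homotopy classes of continuous maps $X\to Y$. $\mathsf{R}=\omega_1\times[0,1[$ is the closed long ray, with the lexicographic order and the order topology; $\alpha\in\omega_1$ is identified with $(\alpha,0)\in\mathsf{R}$. A map into $\mathsf{R}$ is bounded if its image has an upper bound in $\mathsf{R}$. The first octant is $\mathsf{C}=\{(x,y)\in\mathsf{R}^2: y\le x\}$ with the induced topology; $\Delta_h=\{(x,0):x\in\mathsf{R}\}$ and $\Delta_d=\{(x,x):x\in\mathsf{R}\}$. The radius of $(x,y)\in\mathsf{C}$ is $x$. The $\omega_1$-octant $\mathsf{C}_{\omega_1,s}$: take copies $\widetilde{C}_\alpha$ of $\mathsf{C}$, $\alpha<\omega_1$. If $s(\alpha)=\uparrow$, the bottom edge of $\widetilde{C}_\alpha$ is its copy of $\Delta_h$ and the top edge its copy of $\Delta_d$; if $s(\alpha)=\downarrow$, the bottom edge is its copy of $\Delta_d$ and the top edge its copy of $\Delta_h$. Glue the top edge of $\widetilde{C}_\alpha$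 to the bottom edge of $\widetilde{C}_{\alpha+1}$ by matching points of equal radius. If $\lambda>0$ is a limit ordinal, the $\widetilde{C}_i$ with $i<\lambda$ accumulate on the bottom edge $B_\lambda$ of $\widetilde{C}_\lambda$: a point of radius $x>0$ on $B_\lambda$ has as neighborhood basis the sets $V\cup\{q\in\bigcup_{\mu\le i<\lambda}\widetilde{C}_i\setminus B_\mu : a<\mathrm{radius}(q)<b\}$, where $\mu<\lambda$, $a<x<b$, $B_\mu$ is the bottom edge of $\widetilde{C}_\mu$, and $V$ is a relatively open subset of $\widetilde{C}_\lambda$ disjoint from its top edge whose intersection with $B_\lambda$ is the set of points of $B_\lambda$ with radius in $]a,b[$. Other points of positive radius have the neighborhoods coming from the gluing. (Only one point of radius $0$, the one of $\widetilde C_0$, belongs to the region considered below.) Let $I_\alpha\subset\widetilde{C}_\alpha$ be a line segment joining $(\alpha,0)$ to $(\alpha+1,\alpha+1)$ if $s(\alpha)=\uparrow$, and joining $(\alpha,\alpha)$ to $(\alpha+1,0)$ if $s(\alpha)=\downarrow$; concretely, $I_\alpha$ is the graph $y=\varphi_\alpha(x)$, $x\in[\alpha,\alpha+1]$, of an increasing homeomorphism $\varphi_\alpha\colon[\alpha,\alpha+1]\to[0,\alpha+1]$ with $\varphi_\alpha(x)\le x$ if $s(\alpha)=\uparrow$, and of a decreasing homeomorphism $\varphi_\alpha\colon[\alpha,\alpha+1]\to[0,\alpha]$ (constant $0$ if $\alpha=0$) if $s(\alpha)=\downarrow$. The union $\Delta_{\omega_1}=\bigcup_{\alpha<\omega_1}I_\alpha$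 is a ''diagonal'', homeomorphic to $\mathsf{R}$ via the radius. $\mathsf{C}_{\omega_1,s}$ is the closed region below this diagonal, that is, the union of the sets $C_\alpha\subset\widetilde{C}_\alpha$, where $C_\alpha$ consists of all points of $\widetilde{C}_\alpha$ of radius $\ge\alpha+1$ together with the points $(x,y)$ with $\alpha\le x\le\alpha+1$ lying between the bottom edge and $I_\alpha$ (inclusive), i.e. $y\le\varphi_\alpha(x)$ if $s(\alpha)=\uparrow$ and $y\ge\varphi_\alpha(x)$ if $s(\alpha)=\downarrow$. It has the induced topology. $\Delta_\alpha\subset\mathsf{C}_{\omega_1,s}$ is the copy of $\mathsf{R}$ which follows $\Delta_{\omega_1}$ up to radius $\alpha$ and then the bottom edge of $C_\alpha$ (the points of radius $\ge\alpha$ of the bottom edge of $\widetilde{C}_\alpha$). $M_{\omega_1,s}$ is the quotient of $\mathsf{C}_{\omega_1,s}$ obtained by identifying each point of $\Delta_{\omega_1}$ with the point of $\Delta_0$ of the same radius. $\mathbb{P}_{\omega_1,s}=\langle\omega_1,\prec\rangle$, where $\prec$ is the reflexive and transitive closure of the relation $\prec'$ given by $\gamma\prec'\gamma+1$ if $s(\gamma)=\uparrow$ and $\gamma+1\prec'\gamma$ if $s(\gamma)=\downarrow$, for $\gamma<\omega_1$. $W\subset\mathbb{P}_{\omega_1,s}$ is adapted if: (i) $\gamma\in W$ and $\gamma\prec\gamma'$ imply $\gamma'\in W$; (ii) for every limit ordinal $0<\beta<\omega_1$ there exists $\gamma(\beta)<\beta$ such that for all $\gamma'\in[\gamma(\beta),\beta[$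 one has $\gamma'\in W\Leftrightarrow\beta\in W$; (iii) if there is $\beta<\omega_1$ with $\gamma\in W$ for all $\gamma\in[\beta,\omega_1[$, then $0\in W$. *)

(* Defs.v *)
From HB Require Import structures.
From Stdlib Require Import Relation_Operators.
From mathcomp Require Import all_boot all_order all_algebra generic_quotient.
From mathcomp Require Import all_classical all_reals all_analysis.
From mathcomp Require wochoice.
Import Order.TTheory GRing.Theory Num.Theory.
Import numFieldNormedType.Exports.

Set Implicit Arguments.
Unset Strict Implicit.
Unset Printing Implicit Defensive.

Local Open Scope order_scope.
Local Open Scope classical_set_scope.
Local Open Scope quotient_scope.

Definition set_nat_wo : rel (set nat) := sval (wochoice.well_ordering_principle (set nat)).

Lemma set_nat_woP : wochoice.well_order set_nat_wo.
Proof. exact: (svalP (wochoice.well_ordering_principle (set nat))). Qed.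

(* The elements of a well-ordered uncountable set having countably many
   predecessors form a well-ordered set of type omega_1 (omega1_least,
   omega1_countable, omega1_uncountable). *)
Definition omega1 : Type :=
  {X : set nat | countable [set Y | set_nat_wo Y X]}.

HB.instance Definition _ := SubType.on omega1.
HB.instance Definition _ := [Choice of omega1 by <:].

Fact omega1_display : Order.disp_t. Proof. exact: Order.Disp tt tt. Qed.

Definition omega1_le (a b : omega1) : bool := set_nat_wo (val a) (val b).

Lemma set_nat_wo_chain : wochoice.wo_chain set_nat_wo (fun=> true).
Proof. by move=> A _ Aneq; exact: set_nat_woP. Qed.

Lemma set_nat_wo_refl X : set_nat_wo X X.
Proof. exact: (wochoice.wo_chain_reflexive set_nat_wo_chain). Qed.

Lemma set_nat_wo_anti : antisymmetric set_nat_wo.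
Proof. by move=> X Y; exact: (wochoice.wo_chain_antisymmetric set_nat_wo_chain). Qed.

Lemma set_nat_wo_total : total set_nat_wo.
Proof. by move=> X Y; exact: (wochoice.wo_chainW set_nat_wo_chain). Qed.

Lemma set_nat_wo_min (A : set (set nat)) : A !=set0 ->
  exists2 X, A X & forall Y, A Y -> set_nat_wo X Y.
Proof.
move=> [X0 AX0].
have [|X [[XA Xlb] _]] := @set_nat_woP (fun Y => `[< A Y >]).
  by exists X0; exact/asboolP.
exists X; first by move/asboolP : XA.
by move=> Y AY; apply: Xlb; apply/asboolP.
Qed.

Lemma set_nat_wo_trans : transitive set_nat_wo.
Proof.
move=> Y X Z XY YZ.
have [|m mA mlb] := @set_nat_wo_min [set X; Y; Z].
  by exists X; left; left.
have mX : set_nat_wo m X by apply: mlb; left; left.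
have mY : set_nat_wo m Y by apply: mlb; left; right.
have mZ : set_nat_wo m Z by apply: mlb; right.
case: mA => [[|]|] /= E; subst m => //.
- by have -> : X = Y by apply: set_nat_wo_anti; rewrite XY mX.
- have <- : Y = Z by apply: set_nat_wo_anti; rewrite YZ mY.
  exact: XY.
Qed.

Lemma omega1_le_refl : reflexive omega1_le.
Proof. by move=> a; exact: set_nat_wo_refl. Qed.

Lemma omega1_le_anti : antisymmetric omega1_le.
Proof. by move=> a b ab; apply: val_inj; exact: set_nat_wo_anti. Qed.

Lemma omega1_le_trans : transitive omega1_le.
Proof. by move=> a b c; exact: set_nat_wo_trans. Qed.

Lemma omega1_le_total : total omega1_le.
Proof. by move=> a b; exact: set_nat_wo_total. Qed.

HB.instance Definition _ := Order.Le_isPOrder.Build omega1_display omega1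
  omega1_le_refl omega1_le_anti omega1_le_trans.
HB.instance Definition _ := Order.POrder_isTotal.Build omega1_display omega1
  omega1_le_total.

Lemma omega1_countable (a : omega1) : countable [set b : omega1 | b <= a].
Proof.
have /countable_injP[f finj] := valP a.
apply/countable_injP; exists (f \o val) => b c; rewrite !inE /= => ba ca.
by move/(finj _ _ (mem_set ba) (mem_set ca)) => /val_inj.
Qed.

Lemma set_nat_uncountable : ~ countable [set: set nat].
Proof.
move=> /countable_injP[f finj].
pose D := [set n | exists2 X, f X = n & ~ X n].
have [DfD|nDfD] := pselect (D (f D)); last by apply: (nDfD); exists D.
by case: (DfD) => X /finj; rewrite !inE => -> //; exact.
Qed.

Lemma omega1_uncountable : ~ countable [set: omega1].
Proof.
move=> /countable_injP[f finj].
have cS : countable [set X | countable [set Y | set_nat_wo Y X]].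
  apply/countable_injP.
  pose g X := if insub X is Some a then f (a : omega1) else 0%N.
  exists g => X Y; rewrite !inE => cX cY; rewrite /g !insubT/=.
  by move=> /finj; rewrite !inE => /(_ Logic.I Logic.I)[].
have [allS|] := pselect (forall X, countable [set Y | set_nat_wo Y X]).
  apply: set_nat_uncountable; move: cS; congr countable.
  by apply/seteqP; split => X //= _; exact: allS.
move=> /existsNP[X0 nX0].
have [X nX Xlb] := @set_nat_wo_min
  [set X | ~ countable [set Y | set_nat_wo Y X]] (ex_intro _ X0 nX0).
apply: nX.
apply: (@sub_countable _ _ _ ([set X | countable [set Y | set_nat_wo Y X]] `|` [set X])).
  apply: subset_card_le => Y /= YX.
  have [cY|ncY] := pselect (countable [set Z | set_nat_wo Z Y]).
    by left.
  by right; apply: set_nat_wo_anti; rewrite YX Xlb.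
rewrite -bigcup2E; apply: bigcup_countable => // -[|[|n]] _ //=.
Qed.

Lemma omega1_least (A : set omega1) : A !=set0 ->
  {a | A a /\ forall b, A b -> a <= b}.
Proof.
move=> A0; apply: cid; have [a0 Aa0] := A0.
have [|X [a Aa <-] lb] := @set_nat_wo_min (val @` A).
  by exists (val a0); exists a0.
by exists a; split => // b Ab; apply: lb; exists b.
Qed.

Lemma omega1_nonempty : [set: omega1] !=set0.
Proof.
by apply/set0P/eqP => T0; apply: omega1_uncountable; rewrite T0; exact: countable0.
Qed.

Lemma omega1_unbounded (a : omega1) : [set b | a < b] !=set0.
Proof.
apply/set0P/eqP => a0; apply: omega1_uncountable.
have <- : [set b | b <= a] = setT; last exact: omega1_countable.
apply/seteqP; split => // b _ /=; rewrite leNgt; apply/negP => ab.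
by have : [set b | a < b] b by []; rewrite a0.
Qed.

Definition omega1_0 : omega1 := sval (omega1_least omega1_nonempty).

Definition omega1_S (a : omega1) : omega1 := sval (omega1_least (omega1_unbounded a)).

Definition limit_ordinal (a : omega1) : Prop :=
  omega1_0 < a /\ forall b, b < a -> omega1_S b < a.

Definition halfopen (R : realType) : Type := {x : R | (0 <= x < 1)%R}.

HB.instance Definition _ R := SubType.on (halfopen R).
HB.instance Definition _ R := [Choice of halfopen R by <:].
HB.instance Definition _ (R : realType) :=
  [SubChoice_isSubOrder of halfopen R by <: with ring_display].

Definition halfopen0 (R : realType) : halfopen R :=
  Sub 0%R (introT andP (conj (lexx 0%R) ltr01)).

Definition longray (R : realType) : Type :=
  order_topology (omega1 *l halfopen R).

HB.instance Definition _ R := OrderTopological.on (longray R).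

Definition of_omega1 (R : realType) (a : omega1) : longray R := (a, halfopen0 R).

Definition octant (R : realType) : Type :=
  [set p : longray R * longray R | p.2 <= p.1].

Definition oct_radius (R : realType) (c : octant R) : longray R := (val c).1.

Definition oct_height (R : realType) (c : octant R) : longray R := (val c).2.

Definition horizontal_edge (R : realType) : set (octant R) :=
  [set c | oct_height c = of_omega1 R omega1_0].

Definition diagonal_edge (R : realType) : set (octant R) :=
  [set c | oct_height c = oct_radius c].

Section generated_quotient.
Context {T : choiceType} (r : T -> T -> Prop).

Let equiv (x y : T) : bool := `[< clos_refl_sym_trans T r x y >].

Let equiv_refl : reflexive equiv.
Proof. by move=> x; apply/asboolP; exact: rst_refl. Qed.

Let equiv_sym : symmetric equiv.
Proof.
by move=> x y; apply: asbool_equiv_eq; split => xy; exact: rst_sym.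
Qed.

Let equiv_trans : transitive equiv.
Proof.
move=> y x z /asboolP xy /asboolP yz; apply/asboolP; exact: rst_trans yz.
Qed.

Definition gen_equiv : equiv_rel T :=
  EquivRel equiv equiv_refl equiv_sym equiv_trans.

End generated_quotient.

Lemma gen_equivP (T : choiceType) (r : T -> T -> Prop) (x y : T) :
  reflect (clos_refl_sym_trans T r x y) (gen_equiv r x y).
Proof. exact: asboolP. Qed.

Inductive arrow : Type := Up | Down.

Section glued_octants.
Context (R : realType) (s : omega1 -> arrow).
Implicit Types (i mu lambda : omega1) (c : octant R).

Definition bottom_edge i : set (octant R) :=
  if s i is Up then @horizontal_edge R else @diagonal_edge R.

Definition top_edge i : set (octant R) :=
  if s i is Up then @diagonal_edge R else @horizontal_edge R.

Definition glue (p q : omega1 * octant R) : Prop :=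
  [/\ q.1 = omega1_S p.1, top_edge p.1 p.2, bottom_edge q.1 q.2
    & oct_radius p.2 = oct_radius q.2].

Definition glued : Type := {eq_quot (gen_equiv glue)}.

HB.instance Definition _ := Quotient.on glued.
HB.instance Definition _ := Choice.on glued.

Definition in_copy i c : glued := \pi_glued (i, c).

(* Basic neighborhoods of the points on the bottom edge of the copy of a limit
   index [lambda]; [V] is the part lying in that copy. *)
Definition bottom_nbhd lambda mu (a b : longray R) (V : set (octant R)) :
    set glued :=
  in_copy lambda @` V `|`
  ((\bigcup_(i in [set i | mu <= i < lambda])
      in_copy i @` [set c | a < oct_radius c < b])
   `\` in_copy mu @` bottom_edge mu).

(* The gluing contains points of radius zero in all copies. Only that of the copy
   of index [omega1_0] lies in the [region] below, whose points of radius < 1 all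
   come from that copy, so the choice made at radius zero does not affect the
   topology of [region]. *)
Definition on_limit_edge i c : Prop :=
  [/\ limit_ordinal i, bottom_edge i c & of_omega1 R omega1_0 < oct_radius c].

(* The topology of the gluing, except that at a point of positive radius on the
   bottom edge of a limit copy the sets [bottom_nbhd] form a neighborhood
   basis. *)
Definition glued_open (U : set glued) : Prop :=
  forall i c, U (in_copy i c) ->
    (on_limit_edge i c -> exists mu a b V,
       [/\ mu < i, a < oct_radius c < b, open V, V `&` top_edge i = set0 &
           V `&` bottom_edge i = bottom_edge i `&` [set c' | a < oct_radius c' < b]
           /\ bottom_nbhd i mu a b V `<=` U]) /\
    (~ on_limit_edge i c -> nbhs c (in_copy i @^-1` U)).

Local Notation r0 := (of_omega1 R omega1_0).

Lemma radius_continuous : continuous (@oct_radius R).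
Proof.
move=> c; apply: (@continuous_comp (octant R) (longray R * longray R)%type
  (longray R) (@set_val _ _) fst).
  exact: initial_continuous.
exact: cvg_fst.
Qed.

Lemma height_continuous : continuous (@oct_height R).
Proof.
move=> c; apply: (@continuous_comp (octant R) (longray R * longray R)%type
  (longray R) (@set_val _ _) snd).
  exact: initial_continuous.
exact: cvg_snd.
Qed.

Lemma open_radius (a b : longray R) : open [set c : octant R | a < oct_radius c < b].
Proof.
have -> : [set c : octant R | a < oct_radius c < b] = @oct_radius R @^-1` `]a, b[.
  by apply/seteqP; split => c /=; rewrite in_itv.
by apply: open_comp => [c _|]; [exact: radius_continuous|exact: itv_open].
Qed.

Lemma closed_eqf (f g : octant R -> longray R) :
  continuous f -> continuous g -> closed [set c | f c = g c].
Proof.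
move=> cf cg c clc; apply: order_hausdorff => A B fA gB.
have nAB : nbhs c (f @^-1` A `&` g @^-1` B).
  by apply: filterI; [exact: cf|exact: cg].
have [d [/= fgd [Ad Bd]]] := clc _ nAB.
by exists (f d); split => //; rewrite fgd.
Qed.

Lemma closed_top_edge i : closed (top_edge i).
Proof.
rewrite /top_edge; case: (s i); first exact: (closed_eqf height_continuous radius_continuous).
by apply: (closed_eqf height_continuous); exact: cst_continuous.
Qed.

Lemma top_bottom_edge i c : top_edge i c -> bottom_edge i c -> oct_radius c = r0.
Proof.
rewrite /top_edge /bottom_edge; case: (s i) => /= h1 h2.
- by rewrite -h1 h2.
- by rewrite -h2 h1.
Qed.

Lemma octant_eq c d : oct_radius c = oct_radius d -> oct_height c = oct_height d -> c = d.
Proof.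
rewrite /oct_radius /oct_height => rcd hcd; apply: val_inj.
by rewrite [LHS]surjective_pairing rcd hcd -surjective_pairing.
Qed.

Lemma top_edge_inj i c d :
  top_edge i c -> top_edge i d -> oct_radius c = oct_radius d -> c = d.
Proof.
rewrite /top_edge; case: (s i) => /= hc hd rcd; apply: octant_eq => //.
- by rewrite hc hd.
- by rewrite hc hd.
Qed.

Lemma bottom_edge_inj i c d :
  bottom_edge i c -> bottom_edge i d -> oct_radius c = oct_radius d -> c = d.
Proof.
rewrite /bottom_edge; case: (s i) => /= hc hd rcd; apply: octant_eq => //.
- by rewrite hc hd.
- by rewrite hc hd.
Qed.

Lemma succ_gt i : i < omega1_S i.
Proof. by have [] := svalP (omega1_least (omega1_unbounded i)). Qed.

Lemma succ_le i j : i < j -> omega1_S i <= j.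
Proof. by have [_ h] := svalP (omega1_least (omega1_unbounded i)); exact: h. Qed.

Lemma succ_inj i j : omega1_S i = omega1_S j -> i = j.
Proof.
move=> ij; apply/eqP; rewrite eq_le !leNgt; apply/andP; split; apply/negP.
- by move=> /succ_le; rewrite -ij leNgt succ_gt.
- by move=> /succ_le; rewrite ij leNgt succ_gt.
Qed.

Lemma zero_le i : omega1_0 <= i.
Proof. by have [_ h] := svalP (omega1_least omega1_nonempty); exact: h. Qed.

Lemma r0_le r : r0 <= r.
Proof.
case: r => i x; rewrite /of_omega1 leEprodlexi/= zero_le /=.
by apply/implyP => _; have /andP[] := valP x.
Qed.

Lemma radius_lt (r : longray R) : exists r', r < r'.
Proof.
case: r => i x; exists (of_omega1 R (omega1_S i)).
by rewrite ltEprodlexi/= (ltW (succ_gt _)) (lt_geF (succ_gt _)).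
Qed.

Lemma glued_classP i c j d : in_copy i c = in_copy j d ->
  oct_radius c = oct_radius d /\
  (r0 < oct_radius c ->
   [\/ (i, c) = (j, d), glue (i, c) (j, d) | glue (j, d) (i, c)]).
Proof.
move=> /eqmodP/gen_equivP icjd.
pose P (p q : omega1 * octant R) := oct_radius p.2 = oct_radius q.2 /\
  (r0 < oct_radius p.2 -> [\/ p = q, glue p q | glue q p]).
suff : forall p q, clos_refl_sym_trans _ glue p q -> P p q by move=> H; exact: (H _ _ icjd).
have top_bot p q t : r0 < oct_radius q.2 -> glue p q -> glue q t -> False.
  move=> rq [_ _ bq _] [_ tq _ _]; move: rq.
  by rewrite (top_bottom_edge tq bq) ltxx.
move=> p q; elim => {p q} [p q pq|p|p q _ [rpq pq]|p q t _ [rpq pq] _ [rqt qt]].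
- by split; [case: pq|move=> _; apply: Or32].
- by split => // _; apply: Or31.
- split => // rq; have /pq[->|?|?] : r0 < oct_radius p.2 by rewrite rpq.
  + exact: Or31.
  + exact: Or33.
  + exact: Or32.
- split; first by rewrite rpq.
  move=> rp; have rq : r0 < oct_radius q.2 by rewrite -rpq.
  case: (pq rp) => [->|gpq|gqp]; first exact: qt.
  + case: (qt rq) => [<-|gqt|gtq]; first exact: Or32.
      by case: (top_bot _ _ _ rq gpq gqt).
    apply: Or31; case: gpq gtq => q1 tp _ _ [q1' tt _ _].
    have pt : p.1 = t.1 by apply: succ_inj; rewrite -q1 -q1'.
    rewrite [LHS]surjective_pairing [RHS]surjective_pairing -pt; congr pair.
    by apply: (top_edge_inj tp); rewrite ?pt// rpq.
  + case: (qt rq) => [<-|gqt|gtq]; first exact: Or33.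
      apply: Or31; case: gqp gqt => p1 _ bp _ [t1 _ bt _].
      have pt : p.1 = t.1 by rewrite p1 t1.
      rewrite [LHS]surjective_pairing [RHS]surjective_pairing -pt; congr pair.
      by apply: (bottom_edge_inj bp); rewrite ?pt// rpq.
    by case: (top_bot _ _ _ rq gtq gqp).
Qed.

Lemma bottom_nbhd_sub i mu mu' (a b a' b' : longray R) V V' :
  mu <= mu' -> a <= a' -> b' <= b -> V' `<=` V ->
  bottom_nbhd i mu' a' b' V' `<=` bottom_nbhd i mu a b V.
Proof.
move=> mumu' aa' bb' VV' _ [[c Vc <-]|[[j /= /andP[muj ji] [c /andP[ac cb] <-]] nb]].
  by left; exists c => //; exact: VV'.
right; split.
  exists j; first by rewrite /= ji (le_trans mumu').
  by exists c => //=; rewrite (le_lt_trans aa') ?(lt_le_trans cb).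
move=> -[d bd E]; apply: nb.
have [mu_eq|mu_neq] := eqVneq mu mu'; first by exists d; rewrite -?mu_eq.
have mu_lt : mu < mu' by rewrite lt_neqAle mu_neq.
have [rdc] := glued_classP E.
have rd : r0 < oct_radius d by rewrite rdc (le_lt_trans (r0_le _) ac).
case/(_ rd) => [[muj' _]|[_ td _ _]|[/= mujE _ _ _]].
- by move: muj; rewrite -muj' leNgt mu_lt.
- by move: rd; rewrite (top_bottom_edge td bd) ltxx.
- have := lt_le_trans mu_lt muj; rewrite mujE => /lt_trans /(_ (succ_gt _)).
  by rewrite ltxx.
Qed.

Lemma glued_openT : glued_open setT.
Proof.
move=> i c _; split=> [[[i0 _] bc rc]|_]; last exact: filterT.
have [b rb] := radius_lt (oct_radius c).
exists omega1_0, r0, b, ([set c' | r0 < oct_radius c' < b] `\` top_edge i).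
split => //.
- by rewrite rc.
- rewrite setDE; apply: openI; first exact: open_radius.
  by rewrite openC; exact: closed_top_edge.
- by rewrite setDE -setIA setICl setI0.
split=> //; apply/seteqP; split => d /= [].
  by move=> [].
move=> bd rd; split => //; split => // td.
by move: rd; rewrite (top_bottom_edge td bd) ltxx.
Qed.

Lemma glued_openI (U1 U2 : set glued) :
  glued_open U1 -> glued_open U2 -> glued_open (U1 `&` U2).
Proof.
move=> oU1 oU2 i c [/oU1[l1 n1] /oU2[l2 n2]]; split => [lic|nlic]; last first.
  exact: filterI (n1 nlic) (n2 nlic).
have [mu1 [a1 [b1 [V1 [mu1i /andP[a1c cb1] oV1 tV1 [bV1 V1U]]]]]] := l1 lic.
have [mu2 [a2 [b2 [V2 [mu2i /andP[a2c cb2] oV2 tV2 [bV2 V2U]]]]]] := l2 lic.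
exists (Order.max mu1 mu2), (Order.max a1 a2), (Order.min b1 b2), (V1 `&` V2).
split.
- by rewrite gt_max mu1i.
- by rewrite gt_max lt_min a1c a2c cb1.
- exact: openI.
- by rewrite -setIA tV2 setI0.
split.
  rewrite setIIl bV1 bV2; apply/seteqP; split => d /=.
    move=> [[bd /andP[? ?]] [_ /andP[? ?]]]; split => //.
    by rewrite gt_max lt_min; apply/andP; split; apply/andP.
  rewrite gt_max lt_min => -[bd /andP[/andP[? ?] /andP[? ?]]].
  by split; split => //; apply/andP.
rewrite subsetI; split.
- apply: subset_trans V1U; apply: bottom_nbhd_sub => //.
  + by rewrite le_max lexx.
  + by rewrite le_max lexx.
  + by rewrite ge_min lexx.
- apply: subset_trans V2U; apply: bottom_nbhd_sub => //.
  + by rewrite le_max lexx orbT.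
  + by rewrite le_max lexx orbT.
  + by rewrite ge_min lexx orbT.
Qed.

Lemma glued_open_bigU (I : Type) (U : I -> set glued) :
  (forall k, glued_open (U k)) -> glued_open (\bigcup_k U k).
Proof.
move=> oU i c [k _ Ukc]; have [l n] := oU k i c Ukc; split => [lic|nlic].
  have [mu [a [b [V [? ? ? ? [? VU]]]]]] := l lic.
  exists mu, a, b, V; split => //; split => // x /VU Ux; by exists k.
by apply: filterS (n nlic) => d Ud; exists k.
Qed.

HB.instance Definition _ :=
  isOpenTopological.Build glued glued_openT glued_openI glued_open_bigU.

End glued_octants.

Section surface.
Context (R : realType) (s : omega1 -> arrow).
Context (phi : omega1 -> longray R -> longray R).
Implicit Types (i gamma : omega1) (c : octant R).

Definition homeomorphism_on (A B : set (longray R))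
    (f : longray R -> longray R) : Prop :=
  [/\ set_bij A B f, {within A, continuous f} &
      exists2 g : longray R -> longray R,
        {within B, continuous g} & {in A, cancel f g}].

Definition increasing_homeomorphism (A B : set (longray R))
    (f : longray R -> longray R) : Prop :=
  homeomorphism_on A B f /\ {in A &, {homo f : x y / x < y}}.

Definition decreasing_homeomorphism (A B : set (longray R))
    (f : longray R -> longray R) : Prop :=
  homeomorphism_on A B f /\ {in A &, {homo f : x y / x < y >-> y < x}}.

(* [phi i] is only relevant on [J]. *)
Definition diagonal_segments : Prop :=
  forall i, let J := `[of_omega1 R i, of_omega1 R (omega1_S i)] in
  match s i with
  | Up =>
      increasing_homeomorphism J `[of_omega1 R omega1_0, of_omega1 R (omega1_S i)] (phi i)
      /\ forall x, J x -> phi i x <= x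
  | Down =>
      if i == omega1_0 then forall x, J x -> phi i x = of_omega1 R omega1_0
      else decreasing_homeomorphism J `[of_omega1 R omega1_0, of_omega1 R i] (phi i)
  end.

Definition segment i : set (octant R) :=
  [set c | of_omega1 R i <= oct_radius c <= of_omega1 R (omega1_S i) /\
           oct_height c = phi i (oct_radius c)].

Definition below_segment i : set (octant R) :=
  [set c | of_omega1 R i <= oct_radius c <= of_omega1 R (omega1_S i) /\
           if s i is Up then oct_height c <= phi i (oct_radius c)
           else phi i (oct_radius c) <= oct_height c].

Definition piece i : set (octant R) :=
  [set c | of_omega1 R (omega1_S i) <= oct_radius c] `|` below_segment i.

Definition region : Type :=
  \bigcup_(i : omega1) in_copy s i @` piece i.

Definition Delta gamma : set region :=
  [set p | (exists i c, [/\ segment i c, oct_radius c <= of_omega1 R gamma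
                          & val p = in_copy s i c])
        \/ (exists c, [/\ bottom_edge s gamma c, of_omega1 R gamma <= oct_radius c
                        & val p = in_copy s gamma c])].

Definition diagonal_glue (p q : region) : Prop :=
  exists i c c', [/\ segment i c, bottom_edge s omega1_0 c', oct_radius c = oct_radius c',
    val p = in_copy s i c & val q = in_copy s omega1_0 c'].

Definition surface : Type := {eq_quot (gen_equiv diagonal_glue)}.

HB.instance Definition _ := Quotient.on surface.
HB.instance Definition _ := Topological.copy surface (quotient_topology surface).

Definition unbounded_set (f : surface -> longray R) : set omega1 :=
  [set gamma | ~ has_ubound (f @` (\pi_surface @` Delta gamma))].

End surface.

Section adapted.
Context (s : omega1 -> arrow).

Definition prec1 (gamma gamma' : omega1) : Prop :=
  (s gamma = Up /\ gamma' = omega1_S gamma) \/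
  (s gamma' = Down /\ gamma = omega1_S gamma').

Definition prec : omega1 -> omega1 -> Prop := clos_refl_trans omega1 prec1.

Definition adapted (W : set omega1) : Prop :=
  [/\ forall gamma gamma', W gamma -> prec gamma gamma' -> W gamma',
      forall beta, limit_ordinal beta ->
        exists2 gamma, gamma < beta &
          forall gamma', gamma <= gamma' < beta -> (W gamma' <-> W beta)
    & (exists beta, forall gamma, beta <= gamma -> W gamma) -> W omega1_0].

End adapted.

Section homotopy.
Context (R : realType) (X Y : topologicalType).

(* Only the values of [H] for times in [0, 1] matter. *)
Definition homotopic (f g : X -> Y) : Prop :=
  exists H : X * R -> Y,
    [/\ {within [set: X] `*` `[0%R, 1%R], continuous H},
        forall x, H (x, 0%R) = f x & forall x, H (x, 1%R) = g x].

(* A homotopy class is represented by the set of its elements. *)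
Definition homotopy_class (f : X -> Y) : set (X -> Y) :=
  [set g | continuous g /\ homotopic f g].

Definition homotopy_classes : set (set (X -> Y)) :=
  homotopy_class @` [set f | continuous f].

End homotopy.

Arguments homotopy_classes R X Y : clear implicits.

(* Main.v *)
Require Import Defs.
From Stdlib Require Import Relation_Operators.
From mathcomp Require Import all_boot all_order all_algebra generic_quotient.
From mathcomp Require Import all_classical all_reals all_analysis.
From mathcomp Require Import ring lra.
Import Order.TTheory GRing.Theory Num.Theory.
Import numFieldNormedType.Exports.

Set Implicit Arguments.
Unset Strict Implicit.
Unset Printing Implicit Defensive.

Local Open Scope order_scope.
Local Open Scope classical_set_scope.
Local Open Scope quotient_scope.

(** A continuous map from the long ray to itself is either eventually constant, or
    satisfies [d <= h x <-> d <= x] for a closed unbounded set of limit ordinals [d].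
    Likewise a continuous map [G] on the octant is bounded, or the set [d <= G] is, for
    a closed unbounded set of [d], the set of points of radius, respectively of height,
    at least [d], according to whether [G] is unbounded on the horizontal edge or only
    on the diagonal. In particular unboundedness on an edge is inherited from the
    horizontal edge by the diagonal, is invariant under homotopy, and the sets [C(f)]
    are adapted.
    If [C(f) = C(g)], then [f] and [g] have the same sets [d <= f], [d <= g] below
    height [d] for a closed unbounded set of [d]; hence there is a common upper bound of
    [f] and [g] that is locally constant where they differ, and moving caps along paths
    up to this bound deforms [f] into [g].
    Conversely an adapted [W] is constant on some final segment of [omega1]. It is
    realized by the map given on each copy of the octant by the radius, the height or a
    constant, truncated from below by a large constant, and, if [W] contains [0] but no
    large ordinal, truncated from above on the copies of large index. *)

(** * Closed unbounded sets of countable ordinals *)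

Section countable_ordinals.
Implicit Types (a b d i j : omega1).

(** Paths from [0] to a bound cannot be chosen continuously in the bound, since the long ray is not
    contractible; the bound must therefore be locally constant wherever a path is really used. Where
    the two maps agree, the homotopy is squeezed between them, so only the set where they differ
    matters. The obstacle is the diagonal, which meets the copies of all indices: if two maps
    bounded on it differed there far out, a cut at any index would separate points of the diagonal
    from their neighbors. When [0] is not in [C(f)], truncating both maps from below by a common
    bound on the diagonal makes them equal there. Closed unbounded sets are stable under countable
    and diagonal intersections only. Copies are handled by diagonal intersections, points by
    countable dense subsets of initial segments, and the times of a homotopy by the rationals. *)

Lemma omega1_ind (P : omega1 -> Prop) :
  (forall a, (forall b, b < a -> P b) -> P a) -> forall a, P a.
Proof.
move=> IH a; apply: contrapT => nPa.
have [m [nPm mlb]] := omega1_least (ex_intro (fun x => ~ P x) a nPa).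
apply: nPm; apply: IH => b bm; apply: contrapT => /mlb.
by rewrite leNgt bm.
Qed.

Lemma lt_succP a b : (a < omega1_S b) = (a <= b).
Proof.
apply/idP/idP => [ab|/le_lt_trans]; last by apply; exact: succ_gt.
by rewrite leNgt; apply/negP => /succ_le; rewrite leNgt ab.
Qed.

Lemma succ_leP a b : (omega1_S a <= b) = (a < b).
Proof. by rewrite leNgt lt_succP ltNge. Qed.

Lemma omega1_cases a :
  [\/ a = omega1_0, exists b, a = omega1_S b | limit_ordinal a].
Proof.
have [a0|a0] := eqVneq a omega1_0; first exact: Or31.
have {}a0 : omega1_0 < a by rewrite lt_neqAle eq_sym a0 zero_le.
have [la|/existsNP[b /not_implyP[ba nSb]]] := pselect (forall b, b < a -> omega1_S b < a).
  exact: Or33.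
apply: Or32; exists b; apply/eqP; rewrite eq_le succ_leP ba andbT.
by move/negP: nSb; rewrite -leNgt.
Qed.

Lemma omega1_seq_ubound (a : nat -> omega1) : exists u, forall n, a n < u.
Proof.
apply: contrapT => nu; apply: omega1_uncountable.
suff <- : \bigcup_n [set b | b <= a n] = setT.
  by apply: bigcup_countable => // n _; exact: omega1_countable.
apply/seteqP; split => // b _; apply: contrapT => nb; apply: nu; exists b => n.
by rewrite ltNge; apply/negP => ba; apply: nb; exists n.
Qed.

Lemma omega1_enum a : exists e : nat -> omega1,
  (forall n, e n <= a) /\ forall b, b <= a -> exists n, e n = b.
Proof.
have /countable_injP[f finj] := omega1_countable a.
have /choice[e eP] : forall n, exists x, x <= a /\
    ((exists2 b, b <= a & f b = n) -> f x = n).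
  move=> n; have [[b ba fb]|nb] := pselect (exists2 b, b <= a & f b = n).
    by exists b.
  by exists a; split => // /nb.
exists e; split=> [n|b ba]; first by have [] := eP n.
exists (f b); have [ea] := eP (f b).
by move=> /(_ (ex_intro2 _ _ b ba erefl)) /finj; rewrite !inE; exact.
Qed.

Lemma omega1_image_ubound (N : omega1 -> omega1) a :
  exists u, forall b, b <= a -> N b < u.
Proof.
have [e [_ eP]] := omega1_enum a.
have [u uP] := omega1_seq_ubound (N \o e).
by exists u => b /eP[n <-]; exact: uP.
Qed.

Definition closed_under (N : omega1 -> omega1) d : Prop :=
  limit_ordinal d /\ forall b, b < d -> N b < d.

(* [P] holds on a closed unbounded set; in this formulation no closure
   property has to be checked. *)
Definition club (P : omega1 -> Prop) : Prop :=
  exists N, forall d, closed_under N d -> P d.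

(** Closing off: [g] iterates a bound [M] of [N] on initial segments, and its least strict upper
    bound [d] is closed under [N]. The successor in [g] makes [d] a limit. *)
Lemma closed_under_unbounded N a : exists2 d, a < d & closed_under N d.
Proof.
have /choice[M MP] : forall b, exists u, forall c, c <= b -> N c < u.
  by move=> b; exact: omega1_image_ubound.
pose g := fix g n := if n is n'.+1 then omega1_S (Order.max (g n') (M (g n'))) else a.
have [d [dP dle]] := omega1_least (omega1_seq_ubound g).
have gd b : b < d -> exists n, b <= g n.
  move=> bd; apply: contrapT => nb; have /dle : forall n, g n < b.
    by move=> n; rewrite ltNge; apply/negP => bg; apply: nb; exists n.
  by rewrite leNgt bd.
exists d; first exact: (dP 0%N).
split; last first.
  move=> b /gd[n bn]; apply: lt_trans (dP n.+1); rewrite /= lt_succP.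
  by rewrite le_max (ltW (MP _ _ bn)) orbT.
split; first by rewrite (le_lt_trans (zero_le a))// (dP 0%N).
move=> b /gd[n bn]; apply: le_lt_trans (dP n.+1).
by rewrite /= succ_leP lt_succP le_max bn.
Qed.

(** The closedness that [club] leaves implicit; it serves for the supremum of the good levels below
    a given one. *)
Lemma closed_under_lub N (A : set omega1) d : A !=set0 ->
  A `<=` closed_under N -> (forall b, A b -> b <= d) ->
  (forall b, b < d -> exists2 b', A b' & b < b') -> closed_under N d.
Proof.
move=> [a0 Aa0] AN ub lub; split; [split|].
- have [[a00 _] _] := AN _ Aa0; exact: lt_le_trans a00 (ub _ Aa0).
- move=> b /lub[b' Ab' bb']; have [[_ h] _] := AN _ Ab'.
  exact: lt_le_trans (h _ bb') (ub _ Ab').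
- move=> b /lub[b' Ab' bb']; have [_ h] := AN _ Ab'.
  exact: lt_le_trans (h _ bb') (ub _ Ab').
Qed.

Lemma clubW (P Q : omega1 -> Prop) :
  (forall d, limit_ordinal d -> P d -> Q d) -> club P -> club Q.
Proof.
by move=> PQ [N NP]; exists N => d Nd; apply: PQ; [case: Nd|exact: NP].
Qed.

Lemma club_all (P : omega1 -> Prop) :
  (forall d, limit_ordinal d -> P d) -> club P.
Proof. by move=> PP; exists id => d [ld _]; exact: PP. Qed.

Lemma clubI (P Q : omega1 -> Prop) :
  club P -> club Q -> club (fun d => P d /\ Q d).
Proof.
move=> [N NP] [M MQ]; exists (fun b => Order.max (N b) (M b)) => d [ld dP].
by split; [apply: NP|apply: MQ]; split => // b /dP; rewrite gt_max => /andP[].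
Qed.

Lemma club_seq (P : nat -> omega1 -> Prop) :
  (forall n, club (P n)) -> club (fun d => forall n, P n d).
Proof.
move=> /choice[N NP].
have /choice[M MP] : forall b, exists u, forall n, N n b < u.
  by move=> b; exact: omega1_seq_ubound.
exists M => d [ld dP] n; apply: NP; split => // b /dP.
exact: lt_trans.
Qed.

(** Diagonal intersection: [M b] bounds all [N i c] with [i, c <= b], so closure under [M], used at
    [Order.max i b], gives closure under each [N i] with [i < d]. *)
Lemma club_diag (P : omega1 -> omega1 -> Prop) :
  (forall i, club (P i)) -> club (fun d => forall i, i < d -> P i d).
Proof.
move=> /choice[N NP].
have /choice[M MP] : forall b, exists u, forall i, i <= b -> forall c, c <= b -> N i c < u.
  move=> b; have /choice[M MP] : forall i, exists u, forall c, c <= b -> N i c < u.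
    by move=> i; exact: omega1_image_ubound.
  have [u uP] := omega1_image_ubound M b.
  by exists u => i /uP Mu c /(MP i) Nc; exact: lt_trans Mu.
exists M => d [ld dP] i id; apply: NP; split => // b bd.
have mbd : Order.max i b < d by rewrite gt_max id.
apply: lt_trans (dP _ mbd); apply: MP; first by rewrite le_max lexx.
by rewrite le_max lexx orbT.
Qed.

Lemma club_gt a : club (fun d => a < d).
Proof. by exists (fun=> a) => d [[d0 _] /(_ _ d0)]. Qed.

Lemma club_unbounded (P : omega1 -> Prop) a : club P ->
  exists d, [/\ a < d, limit_ordinal d & P d].
Proof.
move=> [N NP]; have [d ad Nd] := closed_under_unbounded N a.
by exists d; split; [|case: Nd|exact: NP].
Qed.

Lemma club_choose (T : Type) (size : T -> omega1) (Q : omega1 -> T -> Prop) :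
  (forall b, exists x, Q b x) ->
  club (fun d => forall b, b < d -> exists2 x, Q b x & size x < d).
Proof.
move=> /choice[N NQ]; exists (size \o N) => d [ld dP] b bd.
by exists (N b) => //; exact: dP.
Qed.

End countable_ordinals.

(** * The long ray *)

Section longray_order.
Context (R : realType).
Local Notation LR := (longray R).
Local Notation ord := (of_omega1 R).
Implicit Types (x y z : LR) (a b d : omega1).

Definition lr_index x : omega1 := x.1.

Lemma le_ord a x : (ord a <= x) = (a <= lr_index x).
Proof.
case: x => i r; rewrite /of_omega1 leEprodlexi /lr_index /=.
case: leP => //= _; apply/implyP => _; by have /andP[] := valP r.
Qed.

Lemma lt_ord x a : (x < ord a) = (lr_index x < a).
Proof. by rewrite !ltNge le_ord. Qed.

Lemma ord_le a b : (ord a <= ord b) = (a <= b).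
Proof. by rewrite le_ord. Qed.

Lemma ord_lt a b : (ord a < ord b) = (a < b).
Proof. by rewrite lt_ord. Qed.

Lemma lt_ord_succ x : x < ord (omega1_S (lr_index x)).
Proof. by rewrite lt_ord succ_gt. Qed.

Lemma ord_index_le x : ord (lr_index x) <= x.
Proof. by rewrite le_ord. Qed.

Lemma lr_ltE x y : (x < y) = (x.1 < y.1) || ((x.1 == y.1) && (val x.2 < val y.2)%R).
Proof.
case: x y => [i r] [j t]; rewrite ltEprodlexi /=.
by have [] := ltgtP i j.
Qed.

Lemma halfopen_between (r : halfopen R) (u : R) : (val r < u)%R ->
  exists q : rat, exists2 z : halfopen R, val z = ratr q & (val r < val z < u)%R.
Proof.
move=> ru; have /andP[r0 r1] := valP r.
have ru1 : (val r < Num.min u 1)%R by rewrite lt_min ru.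
have [q] := rat_in_itvoo ru1; rewrite in_itv /= lt_min => /andP[rq /andP[qu q1]].
have q01 : (0 <= (ratr q : R) < 1)%R by rewrite q1 (le_trans r0 (ltW rq)).
by exists q, (exist _ (ratr q : R) q01) => //=; rewrite rq.
Qed.

(** The long ray is not separable but its initial segments are, through the countably many pairs of
    an ordinal [<= b] and a rational. This reduces statements about all points to countable
    intersections. *)
Lemma lr_enum_dense b : exists q : nat -> LR,
  (forall n, q n < ord (omega1_S b)) /\
  forall x y, x < ord (omega1_S b) -> x < y -> exists n, x < q n < y.
Proof.
have [e [eb eP]] := omega1_enum b.
pose half (t : rat) : halfopen R := insubd (halfopen0 R) (ratr t : R).
pose q (n : nat) : LR := if unpickle n is Some (k, t) then (e k, half t) else ord b.
exists q; split.
  move=> n; rewrite /q; case: unpickle => [[k t]|]; rewrite lt_ord ?succ_gt//.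
  by rewrite lt_succP; exact: eb.
move=> [i r] y; rewrite lt_ord lt_succP /= => ib xy.
(* It suffices to look in the cell of index [i]: up to its end if [y] lies in a later cell, up to
   the fraction of [y] otherwise. *)
have [u [ru uy]] : exists u, (val r < u)%R /\
    forall z : halfopen R, (val z < u)%R -> (i, z) < y :> LR.
  move: xy; rewrite lr_ltE /= => /orP[iy|/andP[/eqP iy ry]].
    exists 1%R; split; first by have /andP[] := valP r.
    by move=> z _; rewrite lr_ltE /= iy.
  by exists (val y.2); split => // z zy; rewrite lr_ltE /= iy eqxx zy orbT.
have [t [z zt /andP[rz zu]]] := halfopen_between ru.
have [k ek] := eP _ ib.
have zE : half t = z by apply: val_inj; rewrite zt /half insubdK// -zt; exact: (valP z).
exists (pickle (k, t)); rewrite /q pickleK ek zE uy// lr_ltE /= eqxx rz.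
by rewrite orbT.
Qed.

Lemma lr_dense x y : x < y -> exists z, x < z < y.
Proof.
move=> xy; have [q [_ qP]] := lr_enum_dense (lr_index x).
by have [n] := qP _ _ (lt_ord_succ x) xy; exists (q n).
Qed.

Lemma lr_seq_ubound (u : nat -> LR) : exists b, forall n, u n < ord b.
Proof.
have [b bP] := omega1_seq_ubound (lr_index \o u).
by exists b => n; rewrite lt_ord; exact: bP.
Qed.

Lemma limit_gt0 d : limit_ordinal d -> omega1_0 < d.
Proof. by case. Qed.

Lemma lt_limit d x : limit_ordinal d -> x < ord d -> exists2 b, b < d & x < ord b.
Proof.
move=> [_ ld]; rewrite lt_ord => xd.
by exists (omega1_S (lr_index x)); [exact: ld|exact: lt_ord_succ].
Qed.

End longray_order.

(** * Topology of the long ray *)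

Section longray_topology.
Context (R : realType).
Local Notation LR := (longray R).
Local Notation ord := (of_omega1 R).
Implicit Types (x y z : LR) (a b d : omega1) (T : topologicalType).

Lemma near_gt T (f : T -> LR) t y : {for t, continuous f} -> y < f t ->
  \forall u \near t, y < f u.
Proof.
move=> cf yt; have : nbhs (f t) `]y, +oo[.
  by apply: open_nbhs_nbhs; split; [exact: rray_open|rewrite /= in_itv /= yt].
by move/cf; apply: (@filterS _ _ _ (f @^-1` _)) => u /=; rewrite in_itv /= andbT.
Qed.

Lemma near_lt T (f : T -> LR) t y : {for t, continuous f} -> f t < y ->
  \forall u \near t, f u < y.
Proof.
move=> cf yt; have : nbhs (f t) `]-oo, y[.
  by apply: open_nbhs_nbhs; split; [exact: lray_open|rewrite /= in_itv /= yt].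
by move/cf; apply: (@filterS _ _ _ (f @^-1` _)) => u /=; rewrite in_itv.
Qed.

Lemma lr_continuous_at T (f : T -> LR) t :
  (forall y, y < f t -> \forall u \near t, y < f u) ->
  (forall y, f t < y -> \forall u \near t, f u < y) -> {for t, continuous f}.
Proof.
move=> fl fr U; rewrite itv_nbhsE => -[i [io ti] iU].
apply: (@filterS _ _ _ (f @^-1` [set` i])); first by move=> u /= /iU.
case: i io ti {iU} => [[[]p|[]]] [[]q|[]] //= io; rewrite !in_itv/= ?andbT ?andbF //.
- move=> /andP[/fl pt /fr tq]; near=> u; rewrite /= in_itv /=.
  apply/andP; split; near: u; [exact: pt|exact: tq].
- move=> /fl; apply: filterS => u /= pu; by rewrite in_itv /= pu.
- move=> /fr; apply: filterS => u /= pu; by rewrite in_itv.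
- by move=> _; near=> u; rewrite /= in_itv.
Unshelve. all: by end_near. Qed.

(** Splitting an interval into two half-rays, each possibly the whole ray, lets the one-sided
    statements below discard one of them. *)
Lemma nbhs_lr x (U : set LR) : nbhs x U ->
  exists P : set LR * set LR, [/\ forall z, P.1 z -> P.2 z -> U z,
   P.1 = setT \/ exists2 y, y < x & P.1 = [set z | y < z] &
   P.2 = setT \/ exists2 y, x < y & P.2 = [set z | z < y]].
Proof.
rewrite itv_nbhsE => -[i [io ti] iU].
case: i io ti iU => [[[]p|[]]] [[]q|[]] //= io; rewrite in_itv/= ?andbT ?andbF // => ti iU.
- move/andP: ti => [px xq]; exists ([set z | p < z], [set z | z < q]); split.
  + by move=> z /= pz zq; apply: iU; rewrite /= in_itv /= pz.
  + by right; exists p.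
  + by right; exists q.
- exists ([set z | p < z], setT); split; last by left.
  + by move=> z /= pz _; apply: iU; rewrite /= in_itv /= pz.
  + by right; exists p.
- exists (setT, [set z | z < q]); split; first last.
  + by right; exists q.
  + by left.
  + by move=> z /= _ zq; apply: iU; rewrite /= in_itv /=.
- exists (setT, setT); split; [|by left|by left].
  by move=> z _ _; apply: iU; rewrite /= in_itv.
Qed.

Lemma nbhs_right x (U : set LR) : nbhs x U ->
  exists2 y, x < y & forall z, x <= z < y -> U z.
Proof.
move=> /nbhs_lr[[P Q]] /= [PQU hP hQ].
have Pz z : x <= z -> P z.
  by case: hP => [->//|[y yx ->]] xz /=; exact: lt_le_trans xz.
case: hQ => [Q1|[y xy Qy]].
  have [y xy] := radius_lt x; exists y => // z /andP[/Pz Pz' _].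
  by apply: PQU => //; rewrite Q1.
by exists y => // z /andP[/Pz Pz' zy]; apply: PQU => //; rewrite Qy.
Qed.

Lemma nbhs_left x (U : set LR) : nbhs x U -> ord omega1_0 < x ->
  exists2 y, y < x & forall z, y < z <= x -> U z.
Proof.
move=> /nbhs_lr[[P Q]] /= [PQU hP hQ] x0.
have Qz z : z <= x -> Q z.
  by case: hQ => [->//|[y yx ->]] xz /=; exact: le_lt_trans yx.
case: hP => [P1|[y xy Py]].
  exists (ord omega1_0) => // z /andP[_ /Qz Qz'].
  by apply: PQU => //; rewrite P1.
by exists y => // z /andP[yz /Qz Qz']; apply: PQU => //; rewrite Py.
Qed.

Lemma nbhs_both x (U : set LR) : nbhs x U -> ord omega1_0 < x ->
  exists y z, y < x < z /\ forall t, y < t < z -> U t.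
Proof.
move=> nU x0; have [y yx yU] := nbhs_left nU x0.
have [z xz zU] := nbhs_right nU; exists y, z; rewrite yx xz; split=> // t /andP[yt tz].
have [xt|tx] := leP x t; first by apply: zU; rewrite xt.
by apply: yU; rewrite yt ltW.
Qed.

Lemma open_gt T (f : T -> LR) y : continuous f -> open [set t | y < f t].
Proof.
by move=> cf; rewrite openE => t /= yt; exact: (near_gt (cf t)).
Qed.

Lemma open_lt T (f : T -> LR) y : continuous f -> open [set t | f t < y].
Proof. by move=> cf; rewrite openE => t /= yt; exact: (near_lt (cf t)). Qed.

Lemma closed_ge T (f : T -> LR) y : continuous f -> closed [set t | y <= f t].
Proof.
move=> cf; rewrite (_ : mkset _ = ~` [set t | f t < y]).
  exact/open_closedC/open_lt.
by apply/seteqP; split => t /=; rewrite leNgt => /negP.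
Qed.

Lemma closed_le T (f : T -> LR) y : continuous f -> closed [set t | f t <= y].
Proof.
move=> cf; rewrite (_ : mkset _ = ~` [set t | y < f t]).
  exact/open_closedC/open_gt.
by apply/seteqP; split => t /=; rewrite leNgt => /negP.
Qed.

Lemma open_neq T (f g : T -> LR) : continuous f -> continuous g ->
  open [set t | f t <> g t].
Proof.
move=> cf cg; rewrite openE => t /= /eqP; rewrite neq_lt => /orP[] /lr_dense[z /andP[]] h1 h2.
  rewrite /interior /=; near=> u; apply/eqP; rewrite lt_eqF//; apply: lt_trans (_ : z < g u).
    by near: u; exact: (near_lt (cf t)).
  by near: u; exact: (near_gt (cg t)).
rewrite /interior /=; near=> u; apply/eqP; rewrite gt_eqF//; apply: lt_trans (_ : z < f u).
  by near: u; exact: (near_lt (cg t)).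
by near: u; exact: (near_gt (cf t)).
Unshelve. all: by end_near. Qed.

Lemma closed_enum_dense (A : set LR) b (q : nat -> LR) : closed A ->
  (forall x y, x < ord (omega1_S b) -> x < y -> exists n, x < q n < y) ->
  (forall n, A (q n)) -> forall x, x <= ord b -> A x.
Proof.
move=> cA qd Aq x xb; apply: cA => U /nbhs_right[y xy yU].
have xSb : x < ord (omega1_S b) by rewrite (le_lt_trans xb)// ord_lt succ_gt.
have [n /andP[xq qy]] := qd _ _ xSb xy.
by exists (q n); split => //; apply: yU; rewrite ltW.
Qed.

Lemma lr_bounded_initial (h : LR -> LR) b : continuous h ->
  exists c, forall x, x <= ord b -> h x < ord c.
Proof.
move=> ch; have [q [_ qd]] := lr_enum_dense R b.
have [c cP] := lr_seq_ubound (h \o q); exists (omega1_S c) => x xb.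
rewrite (le_lt_trans (y := ord c)) ?ord_lt ?succ_gt//.
apply: (closed_enum_dense (closed_le (y := ord c) ch) qd _ xb) => n.
exact/ltW/cP.
Qed.

(** For [d] closed under a choice of witnesses, [ord d] is a limit of points of [A], one in [[ord b,
    ord d[] for each [b < d]. *)
Lemma closed_unbounded_club (A : set LR) : closed A ->
  (forall b, exists2 x, ord b <= x & A x) -> club (fun d => A (ord d)).
Proof.
move=> cA Ab.
have /(club_choose (@lr_index R)) : forall b, exists x, ord b <= x /\ A x.
  by move=> b; have [x] := Ab b; exists x.
apply: clubW => d ld dP; apply: cA => U nU.
have [|y yd yU] := nbhs_left nU; first by rewrite ord_lt limit_gt0.
have [b bd yb] := lt_limit ld yd.
have [x [bx Ax]] := dP _ bd; rewrite -(lt_ord x d) => xd.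
by exists x; split => //; apply: yU; rewrite (lt_le_trans yb bx) ltW.
Qed.

End longray_topology.

(** * Unbounded and eventually constant self-maps of the long ray *)

Section unbounded_maps.
Context (R : realType).
Local Notation LR := (longray R).
Local Notation ord := (of_omega1 R).
Implicit Types (x y z : LR) (a b d : omega1) (h : LR -> LR).

Definition unbounded h : Prop := forall b, exists x, ord b <= h x.

Lemma not_unboundedP h : ~ unbounded h -> exists b, forall x, h x < ord b.
Proof.
move=> /existsNP[b nb]; exists b => x; rewrite ltNge; apply/negP => bx.
by apply: nb; exists x.
Qed.

(** Two closed cofinal subsets of the long ray meet. If [h] fell to [ord b] arbitrarily far out, the
    disjoint sets [h <= ord b] and [ord (omega1_S b) <= h] would both be cofinal, the second because
    [h] is bounded on initial segments. *)
Lemma unbounded_cofinal h : continuous h -> unbounded h ->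
  forall b, exists N, forall x, ord N <= x -> ord b < h x.
Proof.
move=> ch uh b; apply: contrapT => /forallNP nN.
have clo : club (fun d => h (ord d) <= ord b).
  apply: (closed_unbounded_club (A := [set x | h x <= ord b])); first exact: closed_le.
  move=> N; have /existsNP[x /not_implyP[Nx hx]] := nN N; exists x => //=.
  by rewrite leNgt; apply/negP.
have chi : club (fun d => ord (omega1_S b) <= h (ord d)).
  apply: (closed_unbounded_club (A := [set x | ord (omega1_S b) <= h x])).
    exact: closed_ge.
  move=> N; have [c hc] := lr_bounded_initial N ch.
  have [x] := uh (Order.max c (omega1_S b)); rewrite le_ord ge_max => /andP[cx bx].
  exists x; last by rewrite /= le_ord.
  by rewrite leNgt; apply/negP => /ltW /hc; rewrite ltNge le_ord cx.
have [d [_ _ [h1 h2]]] := club_unbounded omega1_0 (clubI clo chi).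
by have := le_trans h2 h1; rewrite ord_le leNgt succ_gt.
Qed.

(** Closure under [N], which tells how far out [h] exceeds [ord b], gives one implication; closure
    under [B], which bounds [h] up to [ord b], gives the other. *)
Lemma unbounded_club h : continuous h -> unbounded h ->
  club (fun d => forall x, (ord d <= h x) = (ord d <= x)).
Proof.
move=> ch uh; have /choice[N NP] := unbounded_cofinal ch uh.
have /choice[B BP] : forall b, exists c, forall x, x <= ord b -> h x < ord c.
  by move=> b; exact: lr_bounded_initial.
have cN : club (closed_under N) by exists N.
have cB : club (closed_under B) by exists B.
apply: clubW (clubI cN cB) => d ld [[_ Nd] [_ Bd]] x; apply/idP/idP.
  apply: contraTT; rewrite -!ltNge => /(lt_limit ld)[b bd /ltW /BP].
  by move=> /lt_trans; apply; rewrite ord_lt; exact: Bd.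
move=> dx; rewrite leNgt; apply/negP => /(lt_limit ld)[b bd].
by apply/negP; rewrite -leNgt ltW// NP// (le_trans _ dx)// ord_le ltW// Nd.
Qed.

Lemma unbounded_fixpoint h d : continuous h -> limit_ordinal d ->
  (forall x, (ord d <= h x) = (ord d <= x)) -> h (ord d) = ord d.
Proof.
move=> ch ld hd; apply/eqP; rewrite eq_le hd lexx andbT.
have : closed [set x | h x <= ord d] by exact: closed_le.
apply=> U /nbhs_left[|y yd yU]; first by rewrite ord_lt limit_gt0.
have [z /andP[yz zd]] := lr_dense yd.
exists z; split; last by apply: yU; rewrite yz ltW.
by rewrite /= ltW// ltNge hd -ltNge.
Qed.

(** For each pair [q n < q m] from a countable dense set of values, [h] is eventually above [q n] or
    eventually below [q m], since otherwise two disjoint closed cofinal sets would exist. Beyond all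
    these countably many thresholds, two distinct values of [h] would have such a pair between
    them. *)
Lemma bounded_eventually_constant h : continuous h -> ~ unbounded h ->
  exists N, forall x y, ord N <= x -> ord N <= y -> h x = h y.
Proof.
move=> ch /not_unboundedP[b hb]; have [q [_ qd]] := lr_enum_dense R b.
have /choice[N NP] : forall p : nat * nat, exists N, q p.1 < q p.2 ->
    (forall x, ord N <= x -> q p.1 < h x) \/ (forall x, ord N <= x -> h x < q p.2).
  move=> [n m] /=; apply: contrapT => /forallNP nN.
  have /not_implyP[qnm _] := nN omega1_0.
  have clo : club (fun d => h (ord d) <= q n).
    apply: (closed_unbounded_club (A := [set x | h x <= q n])); first exact: closed_le.
    move=> c; have /not_implyP[_ /not_orP[/existsNP[x /not_implyP[cx hx]] _]] := nN c.
    by exists x => //=; rewrite leNgt; apply/negP.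
  have chi : club (fun d => q m <= h (ord d)).
    apply: (closed_unbounded_club (A := [set x | q m <= h x])); first exact: closed_ge.
    move=> c; have /not_implyP[_ /not_orP[_ /existsNP[x /not_implyP[cx hx]]]] := nN c.
    by exists x => //=; rewrite leNgt; apply/negP.
  have [d [_ _ [h1 h2]]] := club_unbounded omega1_0 (clubI clo chi).
  by have := le_trans h2 h1; rewrite leNgt qnm.
pose u (k : nat) := if unpickle k is Some p then N p else omega1_0.
have [M MP] := omega1_seq_ubound u.
have NM p : N p <= M by have := MP (pickle p); rewrite /u pickleK; exact: ltW.
have key x y : ord M <= x -> ord M <= y -> h x < h y -> False.
  move=> Mx My hxy.
  have bS z : z < ord b -> z < ord (omega1_S b).
    by move=> zb; rewrite (lt_trans zb)// ord_lt succ_gt.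
  have [n /andP[xn ny]] := qd _ _ (bS _ (hb x)) hxy.
  have [m /andP[nm my]] := qd _ _ (bS _ (lt_trans ny (hb y))) ny.
  have Nx : ord (N (n, m)) <= x by rewrite (le_trans _ Mx)// ord_le.
  have Ny : ord (N (n, m)) <= y by rewrite (le_trans _ My)// ord_le.
  have [/(_ _ Nx)|/(_ _ Ny)] := NP (n, m) nm => /=.
    by move=> /(lt_trans xn); rewrite ltxx.
  by move=> /(lt_trans my); rewrite ltxx.
exists M => x y Mx My; case: (ltgtP (h x) (h y)) => // /key kk.
  by have := kk Mx My.
by have := kk My Mx.
Qed.

(* For rational [t], either [h t] fixes large [d' > d] or is constant there;
   hence [h t (ord d')] never lies strictly between [d] and [d'], for any [t]. *)
Lemma unbounded_deform (h : R -> LR -> LR) :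
  (forall t, continuous (h t)) -> (forall x, continuous (h^~ x)) ->
  unbounded (h 0%R) -> unbounded (h 1%R).
Proof.
move=> ch1 ch2 uh0.
pose P (t : R) d := (unbounded (h t) -> forall x, (ord d <= h t x) = (ord d <= x)) /\
   (~ unbounded (h t) -> h t (ord d) < ord d /\
       forall x y, ord d <= x -> ord d <= y -> h t x = h t y).
have Pt t : club (P t).
  have [uht|uht] := pselect (unbounded (h t)).
    by apply: clubW (unbounded_club (ch1 t) uht).
  have [N NP] := bounded_eventually_constant (ch1 t) uht.
  have [b bP] := not_unboundedP uht.
  apply: clubW (clubI (club_gt N) (club_gt b)) => d _ [Nd bd]; split=> // _; split.
    by rewrite (lt_trans (bP _))// ord_lt.
  by move=> x y dx dy; apply: NP; rewrite (le_trans _ dx, le_trans _ dy)// ord_le ltW.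
have PQ : club (fun d => forall n, forall q : rat, unpickle n = Some q -> P (ratr q) d).
  apply: club_seq => n; case: unpickle => [q|]; last by apply: club_all.
  by apply: clubW (Pt (ratr q)) => d _ + _ [<-].
have {}PQ : club (fun d => forall q : rat, P (ratr q) d).
  by apply: clubW PQ => d _ H q; apply: (H (pickle q)); rewrite pickleK.
have [d [_ ld Pd]] := club_unbounded omega1_0 PQ.
have [d' [dd' ld' Pd']] := club_unbounded d PQ.
pose A := [set t : R | ord d < h t (ord d')].
have oA : open A by exact: open_gt.
have gap t : ord d < h t (ord d') -> ord d' <= h t (ord d').
  move=> dt; rewrite leNgt; apply/negP => td'.
  have oB : open (A `&` [set t : R | h t (ord d') < ord d']).
    by apply: openI => //; exact: open_lt.
  have [|t0 [[/= Aq qd'] [q _ qE]]] := @dense_rat R _ _ oB; first by exists t.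
  move: Aq qd'; rewrite /A /= -qE.
  have [uq|uq] := pselect (unbounded (h (ratr q))).
    by move=> _; rewrite ltNge (Pd' q).1// lexx.
  have [hd hc] := (Pd q).2 uq; rewrite (hc _ (ord d)) ?ord_le ?(ltW dd')// => /lt_trans/(_ hd).
  by rewrite ltxx.
have cA : closed A.
  rewrite (_ : A = [set t | ord d' <= h t (ord d')]); first exact: closed_ge.
  apply/seteqP; split => t /=; first exact: gap.
  by apply: lt_le_trans; rewrite ord_lt.
have A0 : A 0%R.
  have : P 0%R d' by have := Pd' 0%R; rewrite rmorph0.
  move=> [/(_ uh0) h0 _].
  by apply: (lt_le_trans (y := ord d')); rewrite ?ord_lt// h0.
have AT : A = setT.
  have cT : connected [set: R] by apply/connected_intervalP => ? ? _ _ ? _.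
  apply: cT; first by exists 0%R.
    by exists A => //; rewrite setTI.
  by exists A => //; rewrite setTI.
have A1 : A 1%R by rewrite AT.
apply: contrapT => uh1.
have : P 1%R d' by have := Pd' 1%R; rewrite rmorph1.
move=> [_ /(_ uh1)[h1 _]].
by have := gap _ A1; rewrite leNgt h1.
Qed.

End unbounded_maps.

(** * Paths from the origin of the long ray *)

Section paths.
Context (R : realType).
Local Notation LR := (longray R).
Local Notation ord := (of_omega1 R).
Implicit Types (x y z : LR) (a b d : omega1) (g : R -> LR) (t u : R).

(* Continuity is not part of the definition: it follows from the other
   properties, see [monotone_path_continuous]. *)
Definition monotone_path a g : Prop :=
  [/\ forall t u, (t <= u)%R -> g t <= g u,
      forall t, (t <= 0)%R -> g t = ord omega1_0,
      forall t, (1 <= t)%R -> g t = ord a &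
      forall y, y <= ord a -> exists t, (0 <= t <= 1)%R /\ g t = y].

Lemma monotone_path_le a g t : monotone_path a g -> g t <= ord a.
Proof.
move=> [gh _ g1 _]; rewrite -(g1 (Num.max 1 t)%R) ?le_max ?lexx//.
by apply: gh; rewrite le_max lexx orbT.
Qed.

Lemma monotone_path_continuous a g : monotone_path a g -> continuous g.
Proof.
move=> mg t; have [gh _ _ gs] := mg.
have gl := monotone_path_le _ mg.
have glt s u : g s < g u -> (s < u)%R.
  by move=> su; rewrite ltNge; apply/negP => /gh; rewrite leNgt su.
apply: lr_continuous_at => y.
  move=> /lr_dense[z /andP[yz zt]]; have [s [_ sz]] := gs z (le_trans (ltW zt) (gl _)).
  have st : (s < t)%R by apply: glt; rewrite sz.
  near=> u; rewrite (lt_le_trans yz)// -sz; apply: gh.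
  by apply: ltW; near: u; exact: lt_nbhsr.
move=> /lr_dense[z /andP[tz zy]]; have [za|az] := leP z (ord a); last first.
  by near=> u; rewrite (le_lt_trans (gl _))// (lt_trans az).
have [s [_ sz]] := gs z za.
have st : (t < s)%R by apply: glt; rewrite sz.
near=> u; rewrite (le_lt_trans _ zy)// -sz; apply: gh.
by apply: ltW; near: u; exact: lt_nbhsl.
Unshelve. all: by end_near. Qed.

Lemma monotone_path0 : monotone_path omega1_0 (fun=> ord omega1_0).
Proof.
split=> // y y0; exists 0%R; rewrite lexx ler01; split=> //.
by apply/eqP; rewrite eq_le y0 r0_le.
Qed.

Lemma monotone_pathS a g : monotone_path a g ->
  exists g', monotone_path (omega1_S a) g'.
Proof.
move=> mg; have [gh g0 g1 gs] := mg; have gl := monotone_path_le _ mg.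
pose half (t : R) : halfopen R := insubd (halfopen0 R) t.
have halfE (t : R) : (0 <= t < 1)%R -> val (half t) = t by move=> t01; rewrite /half insubdK.
pose g' (t : R) : LR := if (t < 1/2)%R then g (2 * t)%R
  else if (t < 1)%R then (a, half (2 * t - 1)%R) else ord (omega1_S a).
exists g'; split.
- move=> t u tu; rewrite /g'; case: ltrP => t2.
    case: ltrP => u2; first by apply: gh; lra.
    by rewrite (le_trans (gl _))//; case: ltrP => _; rewrite ?ord_le ?(ltW (succ_gt _))// le_ord.
  have -> : (u < 1 / 2)%R = false by apply: le_gtF; lra.
  case: ltrP => t1.
    case: ltrP => u1; last by rewrite ltW// lt_ord succ_gt.
    have h : (val (half (2 * t - 1)) <= val (half (2 * u - 1)))%R.
      by rewrite !halfE; [lra|apply/andP; split; lra|apply/andP; split; lra].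
    by rewrite leEprodlexi /= lexx.
  by rewrite ifF//; apply: le_gtF; lra.
- by move=> t t0; rewrite /g' ifT ?g0//; lra.
- by move=> t t1; rewrite /g' !ifF//; apply: le_gtF; lra.
move=> y yS; have [ya|ay] := ltP y (ord a).
  have [t [/andP[t0 t1] ty]] := gs y (ltW ya).
  have {}t1 : (t < 1)%R.
    by rewrite ltNge; apply/negP => /g1; rewrite ty => ya'; rewrite ya' ltxx in ya.
  exists (t / 2)%R; split; first by apply/andP; split; lra.
  by rewrite /g' ifT; [rewrite mulrCA divff ?mulr1// pnatr_eq0|lra].
have [yS'|yS'] := ltP y (ord (omega1_S a)); last first.
  exists 1%R; rewrite lexx ler01; split => //; rewrite /g' !ifF ?ltxx//.
    by apply/eqP; rewrite eq_le yS yS'.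
  by apply: le_gtF; lra.
have ya : y.1 = a.
  by apply/eqP; move: ay yS'; rewrite le_ord lt_ord lt_succP eq_le /lr_index => -> ->.
have /andP[r0 r1] := valP y.2.
exists ((1 + val y.2) / 2)%R; split; first by apply/andP; split; lra.
rewrite /g' ifF; last by apply: le_gtF; lra.
rewrite ifT; last by lra.
rewrite [RHS]surjective_pairing ya; congr pair; apply: val_inj.
rewrite (_ : (2 * _ - 1)%R = val y.2); last by lra.
by rewrite halfE//; apply/andP.
Qed.

(** Countable limits have cofinality [omega]: [c] consists of the running maxima of an
    enumeration. *)
Lemma limit_cofinal a : limit_ordinal a -> exists c : nat -> omega1,
  [/\ forall n m, (n <= m)%N -> c n <= c m, forall n, c n < a
    & forall b, b < a -> exists n, b <= c n].
Proof.
move=> la; have [e [_ eP]] := omega1_enum a.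
pose e' n := if e n < a then e n else omega1_0.
have e'a n : e' n < a by rewrite /e'; case: ifPn => // _; exact: limit_gt0.
pose c := fix c n := if n is n'.+1 then Order.max (c n') (e' n'.+1) else e' 0%N.
exists c; split.
- apply: (homo_leq (r := fun x y : omega1 => x <= y)) => //; first exact: le_trans.
  by move=> n; rewrite /= le_max lexx.
- by elim=> [|n IH] /=; rewrite ?gt_max ?IH e'a.
move=> b ba; have [n en] := eP _ (ltW ba); exists n.
have : e' n = b by rewrite /e' en ba.
by case: n {en} => [|n] /= ->; rewrite ?le_max lexx ?orbT.
Qed.

Lemma monotone_path_lim a : limit_ordinal a ->
  (forall b, b < a -> exists g, monotone_path b g) ->
  exists g, monotone_path a g.
Proof.
move=> la IH; have [c [cmono ca cP]] := limit_cofinal la.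
have /choice[g gP] : forall n, exists g, monotone_path (c n) g by move=> n; exact: IH.
have gh n := let: And4 h _ _ _ := gP n in h.
have g0 n := let: And4 _ h _ _ := gP n in h.
have g1 n := let: And4 _ _ h _ := gP n in h.
have gs n := let: And4 _ _ _ h := gP n in h.
have gl n t := monotone_path_le t (gP n).
pose prev n := if n is n'.+1 then c n' else omega1_0.
(* On [[n, n+1[] the map [G] runs from [ord (prev n)] towards [ord (c n)]: the path to [ord (c n)]
   restarts at [0], and the maximum makes [G] wait until the path has passed the previous
   ordinal. *)
pose G (t : R) : LR := let n := Num.truncn t in
  Order.max (ord (prev n)) (g n (t - n%:R)%R).
have prevc n m : (n < m)%N -> c n <= prev m by case: m => // m; rewrite ltnS /=; exact: cmono.
have Gu t : G t <= ord (c (Num.truncn t)).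
  rewrite /G ge_max gl andbT ord_le; case: Num.truncn => [|n] /=; first exact: zero_le.
  exact: cmono.
have Gh t u : (t <= u)%R -> G t <= G u.
  move=> tu; have := le_truncn tu; rewrite leq_eqVlt => /orP[/eqP tuE|tlu].
    rewrite /G tuE ge_max !le_max lexx /= gh ?orbT//.
    by rewrite lerD2r.
  by rewrite (le_trans (Gu _))// /G le_max ord_le prevc.
have Gs y : y < ord a -> exists t, (0 <= t)%R /\ G t = y.
  move=> /(lt_limit la)[b /cP[n bn] yb].
  have ex : exists n, y <= ord (c n) by exists n; rewrite (le_trans (ltW yb))// ord_le.
  case: (ex_minnP ex) => {b yb n bn ex} n yn nmin.
  have [r [/andP[r0 r1] ry]] := gs n y yn.
  have py : ord (prev n) <= y.
    case: n nmin {yn ry} => [|n] nmin /=; first exact: r0_le.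
    by rewrite leNgt; apply/negP => /ltW/nmin; rewrite ltnn.
  (* If the path [g n] takes the value [y] only at its end, the time [n + 1] already belongs to the
     next interval, on which [G] starts at [ord (c n)]. *)
  have [r1'|r1'] := ltP r 1%R.
    exists (n%:R + r)%R; split; first by rewrite addr_ge0.
    rewrite /G (truncn_def (n := n)); last first.
      by rewrite lerDl r0 /= -natr1 ltrD2l.
    by rewrite addrAC subrr add0r ry max_r.
  exists (n.+1%:R)%R; split => //; rewrite /G natrK subrr g0//= -ry g1//.
  by rewrite max_l// r0_le.
(* The substitution [t / (1 - t)] compresses the half-line of times into [[0, 1[]; the end point
   [ord a] is added at time [1]. *)
pose f (t : R) := if (t < 1)%R then G (t / (1 - t))%R else ord a.
have G_le t : G t <= ord a by rewrite (le_trans (Gu _))// ord_le ltW.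
have fE (t : R) : (t < 1)%R -> (t / (1 - t) = (1 - t)^-1 - 1)%R.
  by move=> t1; field; lra.
exists f; split.
- move=> t u tu; rewrite /f; case: ltrP => t1; case: ltrP => u1 //.
    apply: Gh; rewrite !fE// lerD2r lef_pV2 ?posrE; lra.
  by exfalso; lra.
- move=> t t0; rewrite /f ifT; last by lra.
  have t0' : (t / (1 - t) <= 0)%R by rewrite ler_pdivrMr ?mul0r//; lra.
  have -> : G (t / (1 - t))%R = g 0%N (t / (1 - t))%R.
    rewrite /G; have -> : Num.truncn (t / (1 - t))%R = 0%N.
      by apply/truncn0Pn; rewrite -ltNge; lra.
    by rewrite /= subr0 max_r// r0_le.
  exact: g0.
- by move=> t t1; rewrite /f ltNge t1.
move=> y; rewrite le_eqVlt => /orP[/eqP->|/Gs[r [r0 ry]]].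
  by exists 1%R; rewrite ler01 lexx /f ltxx.
exists (r / (1 + r))%R; have r1 : (0 < 1 + r)%R by lra.
have lt1 : (r / (1 + r) < 1)%R by rewrite ltr_pdivrMr//; lra.
split; first by rewrite divr_ge0 ?(ltW lt1)// ltW.
rewrite /f lt1 -ry; congr G.
by field; apply/andP; split; lra.
Qed.

Lemma monotone_path_exists a : exists g, monotone_path a g.
Proof.
elim/omega1_ind: a => a IH; case: (omega1_cases a) => [->|[b ba]|la].
- by eexists; exact: monotone_path0.
- have [|g gP] := IH b; first by rewrite ba succ_gt.
  by rewrite ba; exact: monotone_pathS gP.
- exact: monotone_path_lim.
Qed.

Lemma lr_path y : exists g, [/\ continuous g,
  forall t, (t <= 0)%R -> g t = ord omega1_0 & forall t, (1 <= t)%R -> g t = y].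
Proof.
have [g gP] := monotone_path_exists (omega1_S (lr_index y)).
have [_ g0 g1 _] := gP.
exists (fun t => Order.min (g t) y); split.
- apply: (@min_fun_continuous _ _ _ g (fun=> y)) => //.
    exact: monotone_path_continuous gP.
  exact: cst_continuous.
- by move=> t /g0 ->; rewrite min_l// r0_le.
- by move=> t /g1 ->; rewrite min_r// ltW// lt_ord_succ.
Qed.

End paths.

(** * Maps on the octant *)

Section octants.
Context (R : realType).
Local Notation LR := (longray R).
Local Notation ord := (of_omega1 R).
Implicit Types (x y z : LR) (a b d : omega1) (o : octant R).

Fact min_le_proof x y : (x, Order.min x y) \in
  [set p : longray R * longray R | p.2 <= p.1].
Proof. by apply/mem_set; rewrite /= ge_min lexx. Qed.

(* The truncation makes [oct] total; it is the point [(x, y)] when [y <= x]. *)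
Definition oct x y : octant R := exist _ (x, Order.min x y) (min_le_proof x y).

Lemma oct_rad x y : oct_radius (oct x y) = x. Proof. by []. Qed.

Lemma oct_hgt x y : y <= x -> oct_height (oct x y) = y.
Proof. by move=> yx; rewrite /oct_height /= min_r. Qed.

Lemma height_le_radius o : oct_height o <= oct_radius o.
Proof. by have := set_valP o. Qed.

Lemma octE o : oct (oct_radius o) (oct_height o) = o.
Proof. by apply: octant_eq => //; rewrite oct_hgt// height_le_radius. Qed.

Lemma id_continuous (T : topologicalType) : continuous (@id T).
Proof. by move=> t; exact: cvg_id. Qed.

Lemma constant_continuous (T Y : topologicalType) (y : Y) : continuous (fun _ : T => y).
Proof. by move=> t; exact: cvg_cst. Qed.

Lemma pair_continuous (T X Y : topologicalType) (u : T -> X) (v : T -> Y) :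
  continuous u -> continuous v -> continuous (fun t => (u t, v t)).
Proof. by move=> cu cv t; exact: (cvg_pair (cu t) (cv t)). Qed.

Lemma oct_continuous2 (T : topologicalType) (u v : T -> LR) :
  continuous u -> continuous v -> continuous (fun t => oct (u t) (v t)).
Proof.
move=> cu cv; apply: continuous_comp_initial => t.
have cm := @min_fun_continuous _ _ _ u v cu cv t.
exact: (cvg_pair (cu t) cm).
Qed.

Lemma closed_oct (A : set (octant R)) d : limit_ordinal d -> closed A ->
  (forall b, b < d -> exists2 o, A o & (ord b <= oct_height o) && (oct_radius o < ord d)) ->
  A (oct (ord d) (ord d)).
Proof.
move=> ld cA Ad; apply: cA => U nU.
have : continuous (fun p : LR * LR => oct p.1 p.2).
  by apply: oct_continuous2 => p; [exact: cvg_fst|exact: cvg_snd].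
move=> /(_ (ord d, ord d) U nU) [[P Q] /= [nP nQ] PQ].
have d0 : ord omega1_0 < ord d by rewrite ord_lt limit_gt0.
have [y1 y1d yP] := nbhs_left nP d0; have [y2 y2d yQ] := nbhs_left nQ d0.
have [|b bd] := lt_limit (x := Order.max y1 y2) ld; first by rewrite gt_max y1d.
rewrite gt_max => /andP[y1b y2b]; have [ o Ao /andP[bo rd]] := Ad _ bd.
exists o; split=> //; rewrite -(octE o); apply: (PQ (_, _)) => /=.
have ho := height_le_radius o.
split; [apply: yP|apply: yQ]; rewrite ?(lt_le_trans y2b bo) ?(lt_le_trans y1b (le_trans bo ho))/=.
  exact: ltW.
exact: ltW (le_lt_trans ho rd).
Qed.

(** Height is at most radius, so a witness of height [>= ord b] and radius [< ord d] has both
    coordinates in [[ord b, ord d[]. Wherever they lie in the octant, such witnesses for all [b < d]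
    accumulate at the diagonal point of radius [ord d]. *)
Lemma heights_unbounded_club (A : set (octant R)) : closed A ->
  (forall b, exists2 o, A o & ord b <= oct_height o) ->
  club (fun d => A (oct (ord d) (ord d))).
Proof.
move=> cA Ab.
have /(club_choose (fun o => lr_index (oct_radius o))) :
  forall b, exists o, A o /\ ord b <= oct_height o by move=> b; have [ o] := Ab b; exists o.
apply: clubW => d ld dP; apply: closed_oct => // b /dP[ o [Ao bo] rd].
by exists o => //; rewrite bo lt_ord.
Qed.

Section function_on_octant.
Context (G : octant R -> LR) (cG : continuous G).

Let row y := fun x => G (oct x y).
Let diag := fun x => G (oct x x).

Let row_continuous y : continuous (row y).
Proof.
move=> x; apply: continuous_comp; last exact: cG.
exact: (@oct_continuous2 LR id (fun=> y) (@id_continuous LR) (@constant_continuous LR LR y) x).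
Qed.

Let diag_continuous : continuous diag.
Proof.
move=> x; apply: continuous_comp; last exact: cG.
exact: (@oct_continuous2 LR id id (@id_continuous LR) (@id_continuous LR) x).
Qed.

Let col_continuous x : continuous (fun y => G (oct x y)).
Proof.
move=> y; apply: continuous_comp; last exact: cG.
exact: (@oct_continuous2 LR (fun=> x) id (@constant_continuous LR LR x) (@id_continuous LR) y).
Qed.

Lemma oct_bounded_initial b : exists c, forall o, oct_radius o <= ord b -> G o < ord c.
Proof.
have [q [_ qd]] := lr_enum_dense R b.
pose u k := if unpickle k is Some (n, m) then G (oct (q n) (q m)) else ord b.
have [c cP] := lr_seq_ubound u; exists (omega1_S c) => o ob.
rewrite (le_lt_trans (y := ord c)) ?ord_lt ?succ_gt// -(octE o).
have ob' := le_trans (height_le_radius o) ob.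
apply: (closed_enum_dense (A := [set x | row (oct_height o) x <= ord c]) _ qd _ ob).
  exact: closed_le.
move=> n /=; apply: (closed_enum_dense (A := [set y | G (oct (q n) y) <= ord c]) _ qd _ ob').
  by apply: closed_le; exact: col_continuous.
by move=> m; have := cP (pickle (n, m)); rewrite /u pickleK => /ltW.
Qed.

(** Any two rows are joined by a path of rows, to which [unbounded_deform] applies, so they are all
    bounded or all unbounded. At radii below [y] the row [y] runs along the diagonal. *)
Let path_row (g : R -> LR) : continuous g ->
  unbounded (row (g 0%R)) -> unbounded (row (g 1%R)).
Proof.
move=> cg; apply: (unbounded_deform (h := fun t => row (g t))) => [t|x].
  exact: row_continuous.
move=> t; apply: (@continuous_comp _ _ _ g (fun y => G (oct x y))); first exact: cg.
exact: col_continuous.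
Qed.

Let row_unbounded y : unbounded (row y) <-> unbounded (row (ord omega1_0)).
Proof.
have [g [cg g0 g1]] := lr_path y.
rewrite -(g0 0%R)// -[in row y](g1 1%R)//; split; last exact: path_row.
have := @path_row (fun t => g (1 - t)%R) _; rewrite subr0 subrr; apply.
have cB : continuous (fun t : R => 1 - t)%R.
  by move=> t; apply: cvgB; [exact: cvg_cst|exact: cvg_id].
by move=> t; exact: (cvg_comp _ _ (cB t) (cg (1 - t)%R)).
Qed.

Let rows_cofinal : unbounded (row (ord omega1_0)) -> forall b m, exists N,
  forall o, oct_height o <= ord b -> ord N <= oct_radius o -> ord m <= G o.
Proof.
move=> u0 b m; have [q [_ qd]] := lr_enum_dense R b.
have /choice[N NP] : forall n, exists N, forall x, ord N <= x -> ord m < row (q n) x.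
  by move=> n; apply: unbounded_cofinal; [exact: row_continuous|exact/row_unbounded].
have [M MP] := omega1_seq_ubound N; exists M => o ob Mo; rewrite -(octE o).
apply: (closed_enum_dense (A := [set y | ord m <= G (oct (oct_radius o) y)]) _ qd _ ob).
  by apply: closed_ge; exact: col_continuous.
by move=> n /=; apply/ltW/NP; rewrite (le_trans _ Mo)// ord_le ltW.
Qed.

(** Take the column of radius [ord d] with [d] closed under [N]. At heights below [ord d] the values
    of [G] exceed every ordinal [< d], hence are at least [ord d]; by continuity so is the value at
    the top of the column, on the diagonal. *)
Lemma horizontal_diagonal_unbounded :
  unbounded (fun x => G (oct x (ord omega1_0))) -> unbounded (fun x => G (oct x x)).
Proof.
move=> u0; have /choice[N NP] := fun b => rows_cofinal u0 b b.
have cN : club (closed_under N) by exists N.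
move=> b; have [d [bd ld [_ Nd]]] := club_unbounded b cN.
exists (ord d); rewrite (le_trans (y := ord d)) ?ord_le ?(ltW bd)//.
have clA : closed [set y | ord d <= G (oct (ord d) y)] by exact: closed_ge.
apply: clA => U nU; have [|y yd yU] := nbhs_left nU; first by rewrite ord_lt limit_gt0.
have [c cd yc] := lt_limit ld yd; exists (ord c); split; last first.
  by apply: yU; rewrite yc ord_le ltW.
rewrite /= leNgt; apply/negP => /(lt_limit ld)[e ed].
apply/negP; rewrite -leNgt; pose k := Order.max c e.
have kd : k < d by rewrite gt_max cd.
apply: (@le_trans _ _ (ord k)); first by rewrite ord_le le_max lexx orbT.
apply: NP; last by rewrite oct_rad ord_le ltW// Nd.
by rewrite oct_hgt ord_le ?(ltW cd)// le_max lexx.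
Qed.

(** Points of unbounded height where [G <= ord m] would force this inequality on the diagonal for a
    closed unbounded set of radii, against [unbounded_club]. *)
Let far_diagonal : unbounded diag -> forall m, exists N, forall o,
  ord N <= oct_height o -> ord m < G o.
Proof.
move=> ud m; apply: contrapT => /forallNP nN.
have : club (fun d => G (oct (ord d) (ord d)) <= ord m).
  apply: (heights_unbounded_club (A := [set o | G o <= ord m])); first exact: closed_le.
  move=> b; have /existsNP[ o /not_implyP[bo om]] := nN b.
  by exists o => //=; rewrite leNgt; apply/negP.
have cd := unbounded_club diag_continuous ud.
move=> /(clubI cd) /(club_unbounded m)[d [md _ [/(_ (ord d)) + dm]]].
by rewrite lexx => /le_trans/(_ dm); rewrite ord_le leNgt md.
Qed.

(** [F] is to be the radius or the height; the two implications come from closure under [N] and [B]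
    as for maps of the long ray. *)
Let club_ge (F : octant R -> LR) :
  (forall m, exists N, forall o, ord N <= F o -> ord m <= G o) ->
  (forall b, exists B, forall o, F o <= ord b -> G o < ord B) ->
  club (fun d => forall o, (ord d <= G o) = (ord d <= F o)).
Proof.
move=> /choice[N NP] /choice[B BP].
have cN : club (closed_under N) by exists N.
have cB : club (closed_under B) by exists B.
apply: clubW (clubI cN cB) => d ld [[_ Nd] [_ Bd]] o; apply/idP/idP.
  apply: contraTT; rewrite -!ltNge => /(lt_limit ld)[b bd /ltW /BP].
  by move=> /lt_trans; apply; rewrite ord_lt; exact: Bd.
move=> dx; rewrite leNgt; apply/negP => /(lt_limit ld)[b bd].
by apply/negP; rewrite -leNgt NP// (le_trans _ dx)// ord_le ltW// Nd.
Qed.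

Lemma horizontal_unbounded_club : unbounded (fun x => G (oct x (ord omega1_0))) ->
  club (fun d => forall o, (ord d <= G o) = (ord d <= oct_radius o)).
Proof.
move=> u0; apply: club_ge; last exact: oct_bounded_initial.
move=> m; have [N NP] := far_diagonal (horizontal_diagonal_unbounded u0) m.
have [M MP] := rows_cofinal u0 N m; exists M => o Mo.
have [oN|No] := leP (oct_height o) (ord N); first exact: MP.
by apply/ltW/NP/ltW.
Qed.

Let rows_bounded : ~ unbounded (row (ord omega1_0)) -> forall b, exists B,
  forall o, oct_height o <= ord b -> G o < ord B.
Proof.
move=> u0 b; have [q [_ qd]] := lr_enum_dense R b.
have /choice[N NP] : forall n, exists N, forall x, row (q n) x < ord N.
  by move=> n; apply: not_unboundedP => /row_unbounded.
have [B BP] := omega1_seq_ubound N; exists (omega1_S B) => o ob; rewrite -(octE o).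
rewrite (le_lt_trans (y := ord B)) ?ord_lt ?succ_gt//.
apply: (closed_enum_dense (A := [set y | G (oct (oct_radius o) y) <= ord B]) _ qd _ ob).
  by apply: closed_le; exact: col_continuous.
by move=> n /=; rewrite ltW// (lt_trans (NP n _))// ord_lt.
Qed.

Lemma diagonal_unbounded_club :
  ~ unbounded (fun x => G (oct x (ord omega1_0))) -> unbounded (fun x => G (oct x x)) ->
  club (fun d => forall o, (ord d <= G o) = (ord d <= oct_height o)).
Proof.
move=> u0 ud; apply: club_ge; last exact: rows_bounded.
by move=> m; have [N NP] := far_diagonal ud m; exists N => o /NP /ltW.
Qed.

Lemma diagonal_bounded : ~ unbounded (fun x => G (oct x x)) ->
  exists c, forall o, G o < ord c.
Proof.
move=> ud; have u0 : ~ unbounded (row (ord omega1_0)).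
  by move/horizontal_diagonal_unbounded.
have [m mP] := not_unboundedP ud.
have [N NP] : exists N, forall o, ord N <= oct_height o -> G o < ord m.
  apply: contrapT => /forallNP nN.
  have : club (fun d => ord m <= G (oct (ord d) (ord d))).
    apply: (heights_unbounded_club (A := [set o | ord m <= G o])); first exact: closed_ge.
    move=> b; have /existsNP[ o /not_implyP[bo om]] := nN b.
    by exists o => //=; rewrite leNgt; apply/negP.
  by move=> /(club_unbounded m)[d [_ _]]; rewrite leNgt mP.
have [B BP] := rows_bounded u0 N; exists (Order.max m B) => o.
have [/BP oB|/ltW/NP om] := leP (oct_height o) (ord N).
  by rewrite (lt_le_trans oB)// ord_le le_max lexx orbT.
by rewrite (lt_le_trans om)// ord_le le_max lexx.
Qed.

End function_on_octant.
End octants.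

(** * The pieces and the surface *)

Section segments.
Context (R : realType) (s : omega1 -> arrow) (phi : omega1 -> longray R -> longray R).
Context (hphi : diagonal_segments s phi).
Local Notation LR := (longray R).
Local Notation ord := (of_omega1 R).
Implicit Types (x y z : LR) (a b d i : omega1) (c : octant R).

Lemma homeomorphism_inverse (A B : set LR) (f : LR -> LR) : homeomorphism_on A B f ->
  exists g : LR -> LR, [/\ {within B, continuous g},
    forall y, B y -> A (g y) /\ f (g y) = y & forall x, A x -> g (f x) = x].
Proof.
move=> [[fAB _ fsurj] _ [g cg fK]]; exists g; split => //.
- by move=> y /fsurj[x Ax <-]; rewrite fK ?inE.
- by move=> x Ax; rewrite fK ?inE.
Qed.

Lemma within_comp_continuous (T X Y : topologicalType) (B : set X) (g : X -> Y) (h : T -> X) :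
  {within B, continuous g} -> continuous h -> (forall t, B (h t)) ->
  continuous (g \o h).
Proof.
move=> /subspace_continuousP cg ch Bh t U /(cg _ (Bh t)) /= nU.
have := ch t _ nU; apply: (@filterS _ _ _ (h @^-1` _)) => u /=; apply; exact: Bh.
Qed.

(* [P c] is the radius of the point of the segment [I_i] at the (truncated) height
   of [c]. *)
Definition segment_coordinate i (P : octant R -> LR) : Prop :=
  [/\ continuous P, forall c, ord i <= P c <= ord (omega1_S i),
      forall c, piece s phi i c <-> P c <= oct_radius c,
      (forall c, P c = oct_radius c -> segment phi i c) /\
      (omega1_0 < i -> forall c, segment phi i c -> P c = oct_radius c) &
      [/\ forall c, bottom_edge s i c -> ord i <= oct_radius c -> P c = ord i,
          omega1_0 < i -> forall c, top_edge s i c -> ord (omega1_S i) <= oct_radius c ->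
            P c = ord (omega1_S i) &
          forall c, top_edge s i c -> P c <= oct_radius c ->
            oct_radius c <= ord (omega1_S i) -> segment phi i c]].

Let J i : set LR := [set x | ord i <= x <= ord (omega1_S i)].

Let ord_S i : ord i <= ord (omega1_S i).
Proof. by rewrite ord_le ltW// succ_gt. Qed.

Let itvE x y : `[x, y]%classic = [set z | x <= z <= y].
Proof. by apply/seteqP; split => z /=; rewrite in_itv. Qed.

(** [P] is the inverse of [phi i] applied to the height, truncated so as to stay in the range. An
    increasing [phi i] bounds the piece from above and a decreasing one from below, so after
    inversion both orientations give the same inequality [P c <= oct_radius c]. *)
Lemma segment_coordinate_up i : s i = Up -> exists P, segment_coordinate i P.
Proof.
move=> si; have := hphi i; rewrite si !itvE => -[[hf mono] philt].
have [g [cg gB gK]] := homeomorphism_inverse hf.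
have monoJ x y : J i x -> J i y -> x < y -> phi i x < phi i y.
  by move=> Jx Jy; apply: mono; rewrite inE.
have mono_le x y : J i x -> J i y -> x <= y -> phi i x <= phi i y.
  by move=> Jx Jy; case: ltgtP => // [/(monoJ _ _ Jx Jy)/ltW|->].
have phiB x : J i x -> phi i x <= ord (omega1_S i).
  by move=> Jx; case: hf => -[/(_ x Jx) /andP[]].
pose top := ord (omega1_S i).
pose P c := g (Order.min (oct_height c) top).
have minB c : ord omega1_0 <= Order.min (oct_height c) top <= top.
  by rewrite ge_min lexx orbT le_min !r0_le.
have PJ c : J i (P c) by have [] := gB _ (minB c).
have phiP c : phi i (P c) = Order.min (oct_height c) top by have [] := gB _ (minB c).
have Ji : J i (ord i) by rewrite /J /= lexx ord_S.
have JSi : J i top by rewrite /J /= lexx ord_S.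
have low c : oct_height c <= top -> phi i (P c) = oct_height c.
  by move=> h; rewrite phiP min_l.
exists P; split.
- apply: (within_comp_continuous cg) => //.
  apply: (@min_fun_continuous _ _ _ (@oct_height R) (fun=> top)).
    exact: height_continuous.
  exact: constant_continuous.
- exact: PJ.
- move=> c; split.
    case=> [Sc|[Jc]]; first by rewrite (le_trans _ Sc)//; have /andP[] := PJ c.
    rewrite si => hc; rewrite leNgt; apply/negP => /(monoJ _ _ Jc (PJ c)).
    by rewrite low ?(le_trans hc (phiB _ Jc))// ltNge hc.
  move=> Pc; have [Sc|cS] := leP top (oct_radius c); [by left|right].
  have Jc : J i (oct_radius c).
    by apply/andP; rewrite (ltW cS); split => //; have /andP[h _] := PJ c; exact: le_trans Pc.
  split => //; rewrite si -(low c); last exact: le_trans (height_le_radius c) (ltW cS).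
  exact: mono_le.
- split=> [c Pc|_ c [Jc hc]].
    split; first by rewrite -Pc; exact: PJ.
    rewrite -Pc low//; apply: le_trans (height_le_radius c) _.
    by rewrite -Pc; have /andP[] := PJ c.
  by rewrite /P hc min_l ?phiB// gK.
rewrite /bottom_edge /top_edge si; split.
- move=> c hc _; apply/eqP; rewrite eq_le; have /andP[-> _] := PJ c; rewrite andbT leNgt.
  apply/negP => /(monoJ _ _ Ji (PJ c)); rewrite low hc ?r0_le//.
  by rewrite ltNge r0_le.
- move=> _ c hc Sc; apply/eqP; rewrite eq_le; have /andP[_ ->] := PJ c; rewrite leNgt.
  apply/negP => /(monoJ _ _ (PJ c) JSi); rewrite phiP hc min_r//.
  by rewrite ltNge phiB.
move=> c hc Pc cS.
have Jc : J i (oct_radius c).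
  by apply/andP; rewrite cS; split => //; have /andP[h _] := PJ c; exact: le_trans Pc.
split => //; apply/eqP; rewrite eq_le {2}hc philt// andbT.
rewrite -(low c); last by rewrite hc.
exact: mono_le.
Qed.

(** For [i = 0] the segment lies along the horizontal edge and its radius is not a function of its
    height. The constant [0] still describes the piece, which is the whole octant, but not the
    segment; hence the hypotheses [omega1_0 < i] in [segment_coordinate]. *)
Lemma segment_coordinate_down i : s i = Down -> exists P, segment_coordinate i P.
Proof.
move=> si; have := hphi i; rewrite si; case: eqVneq => [i0|ni0].
  rewrite itvE => phi0; exists (fun=> ord omega1_0); split.
  - exact: constant_continuous.
  - by move=> c; rewrite i0 lexx ord_le zero_le.
  - move=> c; split=> _; first exact: r0_le.
    have [Sc|cS] := leP (ord (omega1_S i)) (oct_radius c); [by left|right].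
    have Jc : J i (oct_radius c) by rewrite /J /= i0 r0_le -i0 ltW.
    by split => //; rewrite si phi0// r0_le.
  - split=> [c c0|]; last by rewrite i0 ltxx.
    have Jc : J i (oct_radius c) by rewrite /J /= -c0 i0 lexx r0_le.
    split => //; rewrite phi0//; apply/eqP; rewrite eq_le r0_le andbT.
    by rewrite [X in _ <= X]c0 height_le_radius.
  rewrite /top_edge si; split=> [c _ _|/[!i0]|c hc _ cS]; rewrite ?i0 ?ltxx//.
  have Jc : J i (oct_radius c) by rewrite /J /= {1}i0 r0_le.
  by split; [rewrite -i0|rewrite -i0 phi0//].
rewrite !itvE => -[hf mono].
have [g [cg gB gK]] := homeomorphism_inverse hf.
have monoJ x y : J i x -> J i y -> x < y -> phi i y < phi i x.
  by move=> Jx Jy; apply: mono; rewrite inE.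
have mono_le x y : J i x -> J i y -> x <= y -> phi i y <= phi i x.
  by move=> Jx Jy; case: ltgtP => // [/(monoJ _ _ Jx Jy)/ltW|->].
have phiB x : J i x -> phi i x <= ord i.
  by move=> Jx; case: hf => -[/(_ x Jx) /andP[]].
pose P c := g (Order.min (oct_height c) (ord i)).
have minB c : ord omega1_0 <= Order.min (oct_height c) (ord i) <= ord i.
  by rewrite ge_min lexx orbT le_min !r0_le.
have PJ c : J i (P c) by have [] := gB _ (minB c).
have phiP c : phi i (P c) = Order.min (oct_height c) (ord i) by have [] := gB _ (minB c).
have Ji : J i (ord i) by rewrite /J /= lexx ord_S.
have JSi : J i (ord (omega1_S i)) by rewrite /J /= lexx ord_S.
have top0 c : oct_height c = ord omega1_0 -> P c = ord (omega1_S i).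
  move=> hc; apply/eqP; rewrite eq_le; have /andP[_ ->] := PJ c; rewrite leNgt.
  apply/negP => /(monoJ _ _ (PJ c) JSi); rewrite phiP hc min_l ?r0_le//.
  by rewrite ltNge r0_le.
exists P; split.
- apply: (within_comp_continuous cg) => //.
  apply: (@min_fun_continuous _ _ _ (@oct_height R) (fun=> ord i)).
    exact: height_continuous.
  exact: constant_continuous.
- exact: PJ.
- move=> c; split.
    case=> [Sc|[Jc]]; first by rewrite (le_trans _ Sc)//; have /andP[] := PJ c.
    rewrite si => hc; rewrite leNgt; apply/negP => /(monoJ _ _ Jc (PJ c)).
    by rewrite phiP gt_min ltNge hc ltNge phiB.
  move=> Pc; have [Sc|cS] := leP (ord (omega1_S i)) (oct_radius c); [by left|right].
  have Jc : J i (oct_radius c).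
    by apply/andP; rewrite (ltW cS); split => //; have /andP[h _] := PJ c; exact: le_trans Pc.
  split => //; rewrite si.
  have : phi i (oct_radius c) <= phi i (P c).
    exact: mono_le.
  by rewrite phiP le_min => /andP[].
- split=> [c Pc|_ c [Jc hc]].
    split; first by rewrite -Pc; exact: PJ.
    have [ci|ic] := leP (oct_height c) (ord i); first by rewrite -Pc phiP min_l.
    have := lt_le_trans ic (height_le_radius c); rewrite -{1}Pc.
    by move=> /(monoJ _ _ Ji (PJ c)); rewrite phiP (min_r (ltW ic)) ltNge phiB.
  by rewrite /P hc min_l ?phiB// gK.
rewrite /bottom_edge /top_edge si; split.
- move=> c hc ic; apply/eqP; rewrite eq_le; have /andP[-> _] := PJ c; rewrite andbT leNgt.
  apply/negP => /(monoJ _ _ Ji (PJ c)); rewrite phiP hc min_r//.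
  by rewrite ltNge phiB.
- by move=> _ c /top0.
move=> c tc Pc cS; have Pr : P c = oct_radius c.
  by apply/eqP; rewrite eq_le Pc (top0 _ tc).
split; first by rewrite -Pr; exact: PJ.
rewrite -Pr phiP min_l// tc; exact: r0_le.
Qed.

Lemma segment_coordinate_exists i : exists P, segment_coordinate i P.
Proof.
by case si: (s i); [exact: segment_coordinate_up|exact: segment_coordinate_down].
Qed.

End segments.

Lemma gen_equiv_invariant (T : choiceType) (U : Type) (r : T -> T -> Prop) (g : T -> U) :
  (forall x y, r x y -> g x = g y) -> forall x y, gen_equiv r x y -> g x = g y.
Proof.
move=> gr x y /gen_equivP; elim=> {x y} [x y /gr|//|x y _ ->|x y z _ -> _ ->] //.
Qed.

Lemma lt_fun_open (R : realType) (T : topologicalType) (f g : T -> longray R) :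
  continuous f -> continuous g -> open [set t | f t < g t].
Proof.
move=> cf cg; rewrite openE => t /= /lr_dense[z /andP[fz zg]].
rewrite /interior /=; near=> u; apply: (@lt_trans _ _ z).
  by near: u; exact: (near_lt (cf t)).
by near: u; exact: (near_gt (cg t)).
Unshelve. all: by end_near. Qed.

Section surface_points.
Context (R : realType) (s : omega1 -> arrow) (phi : omega1 -> longray R -> longray R).
Context (hphi : diagonal_segments s phi).
Local Notation LR := (longray R).
Local Notation ord := (of_omega1 R).
Implicit Types (x y z : LR) (a b d i : omega1) (c : octant R).

Definition bot i x : octant R := if s i is Up then oct x (ord omega1_0) else oct x x.

Lemma bot_up i x : s i = Up -> bot i x = oct x (ord omega1_0).
Proof. by rewrite /bot => ->. Qed.

Lemma bot_down i x : s i = Down -> bot i x = oct x x.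
Proof. by rewrite /bot => ->. Qed.

Lemma bot_rad i x : oct_radius (bot i x) = x.
Proof. by rewrite /bot; case: (s i). Qed.

Lemma bot_edge i x : bottom_edge s i (bot i x).
Proof.
by rewrite /bottom_edge /bot; case: (s i) => /=; [exact/oct_hgt/r0_le|exact: oct_hgt].
Qed.

Lemma bot_uniq i c : bottom_edge s i c -> c = bot i (oct_radius c).
Proof. by move=> bc; apply: (bottom_edge_inj bc (bot_edge _ _)); rewrite bot_rad. Qed.

Lemma bot_continuous i : continuous (bot i).
Proof.
rewrite /bot; case: (s i) => x.
  exact: (@oct_continuous2 _ LR id (fun=> ord omega1_0) (@id_continuous LR) (@constant_continuous LR LR (ord omega1_0)) x).
exact: (@oct_continuous2 _ LR id id (@id_continuous LR) (@id_continuous LR) x).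
Qed.

Lemma piece_bot i x : piece s phi i (bot i x) <-> ord i <= x.
Proof.
have [P [cP PJ pP _ [bP _ _]]] := segment_coordinate_exists hphi i.
rewrite pP bot_rad; split=> [|ix]; first by apply: le_trans; have /andP[] := PJ (bot i x).
by rewrite bP ?bot_rad//; exact: bot_edge.
Qed.

Lemma piece_radius i c : piece s phi i c -> ord i <= oct_radius c.
Proof.
have [P [cP PJ pP _ _]] := segment_coordinate_exists hphi i.
by rewrite pP; apply: le_trans; have /andP[] := PJ c.
Qed.

Lemma segment_bot i : segment phi i (bot i (ord i)).
Proof.
have [P [cP PJ pP [sP _] [bP _ _]]] := segment_coordinate_exists hphi i.
by apply: sP; rewrite bP ?bot_rad//; exact: bot_edge.
Qed.

Lemma segment_exists i x : ord i <= x <= ord (omega1_S i) ->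
  segment phi i (oct x (phi i x)).
Proof.
move=> ix; split=> //; rewrite oct_rad oct_hgt//.
have := hphi i; case: (s i) => [[_]|].
  exact.
case: eqP => [_ ->//|_ [[[h _ _] _ _] _]]; first exact: r0_le.
have /andP[_ h2] : ord omega1_0 <= phi i x <= ord i := h x ix.
by apply: le_trans h2 _; have /andP[] := ix.
Qed.

Lemma segment_piece i c : segment phi i c -> piece s phi i c.
Proof. by move=> [ic hc]; right; split => //; rewrite hc; case: (s i). Qed.

Lemma region_point i c : piece s phi i c -> in_copy s i c \in
  \bigcup_(j : omega1) in_copy s j @` piece s phi j.
Proof. by move=> pc; apply/mem_set; exists i => //; exists c. Qed.

Definition region_pt i c (pc : piece s phi i c) : region s phi :=
  exist _ (in_copy s i c) (region_point pc).

(* Points outside the piece [C_i] are sent to the point of [Delta_0] of the same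
   radius, which makes [pt i] total and continuous. *)
Definition pt i c : surface s phi :=
  if pselect (piece s phi i c) is left pc then \pi_(surface s phi) (region_pt pc)
  else \pi_(surface s phi) (region_pt ((piece_bot omega1_0 (oct_radius c)).2 (r0_le _))).

Lemma pt_pi i c (r : region s phi) : piece s phi i c -> val r = in_copy s i c ->
  pt i c = \pi_(surface s phi) r.
Proof.
rewrite /pt; case: pselect => // pc _ E; congr (\pi_ _ _).
exact: val_inj.
Qed.

Lemma pt_out i c : ~ piece s phi i c -> pt i c = pt omega1_0 (bot omega1_0 (oct_radius c)).
Proof.
move=> npc; rewrite {1}/pt; case: pselect => // _.
apply/esym; apply: pt_pi => //; exact/piece_bot/r0_le.
Qed.

Lemma region_val (r : region s phi) : exists i c, piece s phi i c /\ val r = in_copy s i c.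
Proof. by have [i _ [c pc <-]] := set_valP r; exists i, c. Qed.

Lemma pt_surj (p : surface s phi) : exists i c, piece s phi i c /\ p = pt i c.
Proof.
elim/quotP: p => r _; have [i [c [pc E]]] := region_val r.
by exists i, c; split=> //; rewrite (pt_pi pc E).
Qed.

Lemma pt_diag i c : segment phi i c -> pt i c = pt omega1_0 (bot omega1_0 (oct_radius c)).
Proof.
move=> sc; have pc := segment_piece sc.
have p0 : piece s phi omega1_0 (bot omega1_0 (oct_radius c)) by apply/piece_bot/r0_le.
rewrite (pt_pi (r := region_pt pc) pc erefl).
rewrite (pt_pi (r := region_pt p0) p0 erefl).
apply/eqmodP/gen_equivP; apply: rst_step.
exists i, c, (bot omega1_0 (oct_radius c)); split => //; last by rewrite bot_rad.
exact: bot_edge.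
Qed.

Lemma pt_low i x : x <= ord i -> pt i (bot i x) = pt omega1_0 (bot omega1_0 x).
Proof.
rewrite le_eqVlt => /orP[/eqP->|xi].
  by rewrite (pt_diag (segment_bot i)) bot_rad.
by rewrite pt_out ?bot_rad// => /piece_bot; rewrite leNgt xi.
Qed.

(** From radius [ord (omega1_S i)] on, both pieces contain the common edge; below it the next piece
    never does. A point of the edge in the piece [i] is then on the segment, which may touch the top
    edge early, for instance along a whole interval when [i = 0] and [s i = Down]. *)
Lemma piece_top i c c' : top_edge s i c -> bottom_edge s (omega1_S i) c' ->
  oct_radius c = oct_radius c' ->
  [\/ piece s phi i c /\ piece s phi (omega1_S i) c',
      segment phi i c /\ ~ piece s phi (omega1_S i) c' |
      ~ piece s phi i c /\ ~ piece s phi (omega1_S i) c'].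
Proof.
move=> tc bc' rcc'; have [Sc|cS] := leP (ord (omega1_S i)) (oct_radius c).
  apply: Or31; split; first by left.
  by rewrite (bot_uniq bc'); apply/piece_bot; rewrite -rcc'.
have np : ~ piece s phi (omega1_S i) c'.
  by move=> /piece_radius; rewrite -rcc' leNgt cS.
have [P [cP PJ pP [sP _] [_ _ tP]]] := segment_coordinate_exists hphi i.
have [pc|npc] := pselect (piece s phi i c); last exact: Or33.
by apply: Or32; split => //; apply: tP => //; [exact/pP|exact: ltW].
Qed.

Lemma segment_top i c : top_edge s i c -> oct_radius c = ord (omega1_S i) ->
  segment phi i c.
Proof.
move=> tc rc; have [P [cP PJ pP _ [_ _ tP]]] := segment_coordinate_exists hphi i.
by apply: tP; rewrite ?rc//; have /andP[] := PJ c.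
Qed.

Lemma segment_low i c : piece s phi i c -> oct_radius c <= ord i -> segment phi i c.
Proof.
have [P [cP PJ pP [sP _] _]] := segment_coordinate_exists hphi i.
move=> /pP Pc ci; apply: sP; apply/eqP; rewrite eq_le Pc (le_trans ci)//.
by have /andP[] := PJ c.
Qed.

Lemma pt_glue i c c' : top_edge s i c -> bottom_edge s (omega1_S i) c' ->
  oct_radius c = oct_radius c' -> pt i c = pt (omega1_S i) c'.
Proof.
move=> tc bc' rcc'; case: (piece_top tc bc' rcc') => -[h1 h2].
- rewrite (pt_pi (r := region_pt h1) h1 erefl).
  rewrite (pt_pi (r := region_pt h2) h2 erefl).
  congr (\pi_ _ _); apply: val_inj => /=.
  by apply/eqmodP/gen_equivP; exact: rst_step.
- by rewrite (pt_diag h1) (pt_out h2) rcc'.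
- by rewrite (pt_out h1) (pt_out h2) rcc'.
Qed.

Section descent.
Context (Y : Type) (G : omega1 -> octant R -> Y).
Context (G_glue : forall i c c', top_edge s i c -> bottom_edge s (omega1_S i) c' ->
  oct_radius c = oct_radius c' -> G i c = G (omega1_S i) c').

Lemma glued_descent : exists g : glued R s -> Y, forall i c, g (in_copy s i c) = G i c.
Proof.
exists (fun q => G (repr q).1 (repr q).2) => i c.
have gl (p q : omega1 * octant R) : Defs.glue s p q -> G p.1 p.2 = G q.1 q.2.
  by move: p q => [j e] [k e'] [/= -> te be r]; exact: G_glue.
apply: (gen_equiv_invariant gl (y := (i, c))).
by apply/eqmodP; rewrite reprK.
Qed.

Context (G_out : forall i c, segment phi i c \/ ~ piece s phi i c ->
  G i c = G omega1_0 (bot omega1_0 (oct_radius c))).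

(** [G_out] expresses at once the compatibility with the gluing of the diagonal to [Delta_0] and the
    convention of [pt] off the pieces. *)
Lemma surface_descent : exists f : surface s phi -> Y, forall i c, f (pt i c) = G i c.
Proof.
have [g gE] := glued_descent.
have fE i c (r : region s phi) : val r = in_copy s i c ->
    g (val (repr (\pi_(surface s phi) r))) = G i c.
  move=> rE; rewrite -gE -rE.
  have gl (p q : region s phi) : diagonal_glue p q -> g (val p) = g (val q).
    move=> [j [e [e' [se be' re -> ->]]]]; rewrite !gE G_out; last by left.
    by rewrite re -(bot_uniq be').
  by apply: (gen_equiv_invariant gl); apply/eqmodP; rewrite reprK.
exists (fun p => g (val (repr p))) => i c.
have pE j e (pe : piece s phi j e) : g (val (repr (pt j e))) = G j e.
  by rewrite (pt_pi (r := region_pt pe) pe erefl); exact: fE.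
have [pc|npc] := pselect (piece s phi i c); first exact: pE.
rewrite pt_out// pE; last exact/piece_bot/r0_le.
by rewrite [RHS]G_out//; right.
Qed.

End descent.

(** An open set of the surface must be induced by an open set of the whole gluing, of which the
    region is only a subspace. [F] extends the projection to all copies, and preimages under [F]
    provide these open sets. *)
Lemma glued_retraction : exists F : glued R s -> surface s phi,
  (forall i c, F (in_copy s i c) = pt i c) /\
  forall r : region s phi, F (val r) = \pi_(surface s phi) r.
Proof.
have [F FE] := glued_descent pt_glue; exists F; split => // r.
have [i [c [pc E]]] := region_val r.
by rewrite E FE (pt_pi pc E).
Qed.

(** Below radius [ord gamma] the bottom edge lies off the piece and [pt] sends it to [Delta_0],
    which is identified with the diagonal; so the edge parametrizes both parts of [Delta gamma]. *)
Lemma Delta_range gamma : \pi_(surface s phi) @` (@Delta R s phi gamma) =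
  range (fun x => pt gamma (bot gamma x)).
Proof.
apply/seteqP; split => [_ [r + <-]|_ [x _ <-]].
  case=> [[i [c [sc cg E]]]|[c [bc gc E]]].
    exists (oct_radius c) => //; rewrite pt_low// -(pt_pi (segment_piece sc) E).
    by rewrite (pt_diag sc).
  have pc : piece s phi gamma c by rewrite (bot_uniq bc); exact/piece_bot.
  by exists (oct_radius c) => //; rewrite -(bot_uniq bc) (pt_pi pc E).
have [gx|xg] := leP (ord gamma) x.
  have px : piece s phi gamma (bot gamma x) by exact/piece_bot.
  exists (region_pt px).
    by right; exists (bot gamma x); rewrite bot_rad; split => //; exact: bot_edge.
  by rewrite -(pt_pi px).
pose i := lr_index x; pose c := oct x (phi i x).
have sc : segment phi i c.
  by apply: segment_exists; rewrite ord_index_le ltW// lt_ord_succ.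
have pc := segment_piece sc.
exists (region_pt pc); first by left; exists i, c; rewrite oct_rad ltW.
by rewrite -(pt_pi pc)// (pt_low (ltW xg)) (pt_diag sc).
Qed.

Lemma unbounded_setE (f : surface s phi -> LR) gamma :
  unbounded_set f gamma <-> unbounded (fun x => f (pt gamma (bot gamma x))).
Proof.
rewrite /unbounded_set /mkset Delta_range; split=> [nub b|u [y yub]].
  apply: contrapT => nb; apply: nub; exists (ord b) => _ [_ [x _ <-] <-].
  by rewrite leNgt; apply/negP => /ltW h; apply: nb; exists x.
have [x] := u (omega1_S (lr_index y)); rewrite leNgt => /negP; apply.
apply: le_lt_trans (lt_ord_succ y); apply: yub.
by exists (pt gamma (bot gamma x)) => //; exists x.
Qed.

End surface_points.

(** * Topology of the surface *)

Section surface_topology.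
Context (R : realType) (s : omega1 -> arrow) (phi : omega1 -> longray R -> longray R).
Context (hphi : diagonal_segments s phi).
Local Notation LR := (longray R).
Local Notation ord := (of_omega1 R).
Local Notation M := (surface s phi).
Local Notation pt := (pt hphi).
Local Notation bot := (@bot R s).
Implicit Types (x y z a b : LR) (i j mu lambda : omega1) (c : octant R) (U : set M).

Definition edge_nbhd lambda x U : Prop := exists mu a b,
  [/\ mu < lambda, a < x < b &
      forall i, mu <= i -> i < lambda -> forall c, a < oct_radius c < b -> U (pt i c)].

Lemma open_surface_glued U : open U -> exists2 V : set (glued R s), glued_open V &
  forall i c, piece s phi i c -> V (in_copy s i c) <-> U (pt i c).
Proof.
move=> [V oV VE]; exists V => // i c pc.
rewrite (pt_pi hphi (r := region_pt pc) pc erefl).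
by have := congr1 (fun A => A (region_pt pc)) VE; rewrite /= /preimage /mkset => ->.
Qed.

Lemma glued_open_copy (V : set (glued R s)) i : glued_open V ->
  open (in_copy s i @^-1` V).
Proof.
move=> oV; rewrite openE => c Vc; have [l n] := oV i c Vc.
have [lic|/n//] := pselect (on_limit_edge s i c).
have [mu [a [b [W [_ acb oW _ [bW WV]]]]]] := l lic.
have Wc : W c.
  have [_ bc _] := lic.
  by have [] : (W `&` bottom_edge s i) c by rewrite bW.
apply: (@filterS _ _ _ W); last by apply: open_nbhs_nbhs.
by move=> e We; apply: WV; left; exists e.
Qed.

Let U0 U := [set x | U (pt omega1_0 (bot omega1_0 x))].

Lemma open_Delta0 U : open U -> open (U0 U).
Proof.
move=> /open_surface_glued[V oV VU].
rewrite (_ : U0 U = bot omega1_0 @^-1` (in_copy s omega1_0 @^-1` V)); last first.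
  by apply/seteqP; split => x /VU; apply; exact/piece_bot/r0_le.
apply: open_comp; last exact: glued_open_copy.
by move=> x _; exact: bot_continuous.
Qed.

Lemma open_pt U i : open U -> open (pt i @^-1` U).
Proof.
move=> oU; have [V oV VU] := open_surface_glued oU.
have [P [cP PJ pP [sP _] _]] := segment_coordinate_exists hphi i.
have oV' := glued_open_copy i oV.
have oU0 : open [set c | U0 U (oct_radius c)].
  by apply: open_comp; [move=> c _; exact: radius_continuous|exact: open_Delta0].
have oP : open [set c | P c < oct_radius c].
  by apply: lt_fun_open => //; exact: radius_continuous.
have oP' : open [set c | oct_radius c < P c].
  by apply: lt_fun_open => //; exact: radius_continuous.
(* [V] decides inside the piece and [U0 U] outside. Where [P c] equals the radius, [c] is on the
   segment and satisfies both conditions, and a point satisfying both belongs to the preimage on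
   either side. *)
rewrite (_ : pt i @^-1` U = (in_copy s i @^-1` V `&` [set c | P c < oct_radius c])
   `|` ([set c | U0 U (oct_radius c)] `&` [set c | oct_radius c < P c])
   `|` (in_copy s i @^-1` V `&` [set c | U0 U (oct_radius c)])).
  by apply: openU; [apply: openU; exact: openI|exact: openI].
have out c : oct_radius c < P c -> ~ piece s phi i c by move=> rP /pP; rewrite leNgt rP.
apply/seteqP; split => c /=.
  case: (ltgtP (P c) (oct_radius c)) => rP Uc.
  - left; left; split => //; apply/VU => //; apply/pP; exact: ltW.
  - left; right; split; last by [].
    by rewrite /U0 /mkset -(pt_out hphi (out _ rP)).
  - right; split; first by apply/VU => //; apply/pP; rewrite rP.
    by rewrite /U0 /mkset -(pt_diag hphi (sP _ rP)).
case=> [[[Vc rP]|[Uc rP]]|[Vc Uc]].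
- by apply/(VU i c) => //; apply/pP; exact: ltW.
- by rewrite pt_out//; exact: out.
have [pc|npc] := pselect (piece s phi i c); first exact/(VU i c).
by rewrite pt_out.
Qed.

Lemma open_edge_nbhd U lambda x : open U -> limit_ordinal lambda -> ord lambda <= x ->
  U (pt lambda (bot lambda x)) -> edge_nbhd lambda x U.
Proof.
move=> oU ll lx Ux; have [V oV VU] := open_surface_glued oU.
have pb : piece s phi lambda (bot lambda x) by exact/piece_bot.
have x0 : ord omega1_0 < x by rewrite (lt_le_trans _ lx)// ord_lt limit_gt0.
have [lim _] := oV lambda (bot lambda x) ((VU _ _ pb).2 Ux).
have [|mu [a [b [W [mul + _ _ [_ WV]]]]]] := lim.
  by split => //; [exact: bot_edge|rewrite bot_rad].
rewrite bot_rad => /andP[ax xb].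
(* Basic neighborhoods omit the bottom edge of the copy [mu]; starting at [omega1_S mu] avoids
   it. *)
have inV i c : omega1_S mu <= i -> i < lambda -> a < oct_radius c < b -> V (in_copy s i c).
  move=> mui il acb; apply: WV; right; split.
    by exists i; [rewrite /= il (le_trans _ mui)// ltW// succ_gt|exists c].
  move=> [e be E]; have [rE] := glued_classP E.
  have re : ord omega1_0 < oct_radius e.
    by rewrite rE; have /andP[ac _] := acb; exact: le_lt_trans (r0_le _) ac.
  case/(_ re) => [[mE _]|[_ te _ _]|[/= mE _ _ _]].
  - by move: mui; rewrite -mE leNgt succ_gt.
  - by move: re; rewrite (top_bottom_edge te be) ltxx.
  - by move: mui; rewrite mE leNgt (lt_trans (succ_gt i)) ?succ_gt.
(* At radius exactly [ord lambda], nearby points of earlier copies may lie off their pieces, so a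
   neighborhood in [Delta_0] is needed as well. At larger radii they all lie in their pieces. *)
have [lx'|] := ltP (ord lambda) x; last first.
  move=> xl; have xE : x = ord lambda by apply/eqP; rewrite eq_le lx xl.
  have Ux0 : U0 U x by move: Ux; rewrite pt_low ?xE.
  have [a' [b' [/andP[a'x xb'] abU]]] := nbhs_both (open_nbhs_nbhs (conj (open_Delta0 oU) Ux0)) x0.
  exists (omega1_S mu), (Order.max a a'), (Order.min b b'); split.
  - by have [_ h] := ll; exact: h.
  - by rewrite gt_max lt_min ax a'x xb.
  move=> i mui il c; rewrite gt_max lt_min => /andP[/andP[ac a'c] /andP[cb cb']].
  have [pc|npc] := pselect (piece s phi i c); first by apply/VU => //; apply: inV => //; rewrite ac.
  by rewrite pt_out//; apply: abU; rewrite a'c.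
exists (omega1_S mu), (Order.max a (ord lambda)), b; split.
- by have [_ h] := ll; exact: h.
- by rewrite gt_max ax lx'.
move=> i mui il c; rewrite gt_max => /andP[/andP[ac lc] cb].
apply/VU; last by apply: inV => //; rewrite ac.
by left; rewrite /= (le_trans _ (ltW lc))// ord_le succ_leP.
Qed.

(** Radii below [ord lambda] need no hypothesis on the edge of [lambda]: near such a point, all
    copies of index close to [lambda] are sent to [Delta_0] by [pt], so openness of [U0 U]
    suffices. *)
Lemma surface_open U : (forall i, open (pt i @^-1` U)) ->
  (forall lambda x, limit_ordinal lambda -> ord lambda <= x ->
     U (pt lambda (bot lambda x)) -> edge_nbhd lambda x U) -> open U.
Proof.
move=> oU eU; have [F [FE Fpi]] := glued_retraction hphi.
have oB i : open (bot i @^-1` (pt i @^-1` U)).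
  by apply: open_comp; [move=> x _; exact: bot_continuous|exact: oU].
have oU0 : open (U0 U) := oB omega1_0.
have eU' lambda x : limit_ordinal lambda -> ord omega1_0 < x ->
    U (pt lambda (bot lambda x)) -> edge_nbhd lambda x U.
  move=> ll x0 Ux; have [|xl] := leP (ord lambda) x; first by move=> lx; exact: eU.
  have Ux0 : U0 U x by move: Ux; rewrite (pt_low _ (ltW xl)).
  have [a [b [/andP[ax xb] abU]]] := nbhs_both (open_nbhs_nbhs (conj oU0 Ux0)) x0.
  have [mu mul xmu] := lt_limit ll xl.
  exists mu, a, (Order.min b (ord mu)); split => //; first by rewrite ax lt_min xb.
  move=> i mui il c; rewrite lt_min => /andP[ac /andP[cb cmu]].
  rewrite pt_out; first by apply: abU; rewrite ac.
  by move=> /(piece_radius hphi); rewrite leNgt (lt_le_trans cmu)// ord_le.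
have oFU : glued_open (F @^-1` U).
  move=> i c; rewrite /preimage /mkset FE => Uc; split => [[ll bc rc]|_]; last first.
    rewrite (_ : (fun t => _) = pt i @^-1` U); first exact: open_nbhs_nbhs.
    by apply/funext => e /=; rewrite FE.
  have cE := bot_uniq bc.
  have [|mu [a [b [mui /andP[ac cb] abU]]]] := eU' i (oct_radius c) ll rc; first by rewrite -cE.
  have Bc : (bot i @^-1` (pt i @^-1` U)) (oct_radius c) by rewrite /= -cE.
  have [a' [b' [/andP[a'c cb'] abB]]] := nbhs_both (open_nbhs_nbhs (conj (oB i) Bc)) rc.
  pose a2 := Order.max a a'; pose b2 := Order.min b b'.
  exists mu, a2, b2, ((pt i @^-1` U `&` [set e | a2 < oct_radius e < b2]) `\` top_edge s i).
  split => //.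
  - by rewrite gt_max lt_min ac a'c cb.
  - rewrite setDE; apply: openI; last by rewrite openC; exact: closed_top_edge.
    by apply: openI; [exact: oU|exact: open_radius].
  - by apply/seteqP; split => e //= [[_ nt]].
  split.
    apply/seteqP; split => e /=; first by move=> [[[_ ?] _]].
    move=> [be abe]; split => //; split.
      split => //; rewrite (bot_uniq be); apply: abB; move: abe.
      by rewrite gt_max lt_min => /andP[/andP[_ ->] /andP[_ ->]].
    move=> te; move: abe; rewrite (top_bottom_edge te be) => /andP[].
    by rewrite ltNge r0_le.
  move=> _ [[e [[/= Ue _] _] <-]|[[j /= /andP[muj ji] [e /= abe <-]] _]] /=.
    by rewrite FE.
  rewrite FE; apply: (abU j) => //; move: abe.
  by rewrite gt_max lt_min => /andP[/andP[-> _] /andP[-> _]].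
exists (F @^-1` U) => //; apply/seteqP; split => r /=; rewrite /preimage /mkset Fpi //.
Qed.

Lemma pt_continuous i : continuous (pt i).
Proof. by apply/continuousP => U; exact: open_pt. Qed.

Lemma pt_bot_continuous i : continuous (fun x => pt i (bot i x)).
Proof.
by move=> x; exact: (cvg_comp _ _ (@bot_continuous R s i x) (@pt_continuous i (bot i x))).
Qed.

Lemma surface_continuous (f : M -> LR) : (forall i, continuous (f \o pt i)) ->
  (forall lambda x (O : set LR), limit_ordinal lambda -> ord lambda <= x -> open O ->
     O (f (pt lambda (bot lambda x))) -> edge_nbhd lambda x (f @^-1` O)) ->
  continuous f.
Proof.
move=> cf ef; apply/continuousP => O oO; apply: surface_open.
  move=> i; rewrite (_ : _ @^-1` _ = (f \o pt i) @^-1` O)//.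
  by have /continuousP := cf i; exact.
by move=> lambda x ll lx Ox; exact: ef.
Qed.

End surface_topology.

(** * Adapted sets *)

Section adapted_sets.
Context (s : omega1 -> arrow) (W : set omega1).
Implicit Types (b d i j : omega1).

(** If [W] and its complement were both cofinal, closing off would give a limit [d] at which both
    accumulate, against the local constancy of [W] at limits. *)
Lemma adapted_eventually_constant : adapted s W -> exists2 beta, omega1_0 < beta &
  (forall i, beta <= i -> W i) \/ (forall i, beta <= i -> ~ W i).
Proof.
move=> [_ lW _]; apply: contrapT => nW.
have nW' b : (exists i, b <= i /\ W i) /\ (exists i, b <= i /\ ~ W i).
  apply: contrapT => nb; apply: nW; exists (omega1_S b).
    by rewrite lt_succP zero_le.
  have bS i : omega1_S b <= i -> b <= i by rewrite succ_leP => /ltW.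
  have [Wb|/forallNP Wb] := pselect (exists i, b <= i /\ W i).
    left=> i /bS bi; apply: contrapT => nWi; apply: nb; split => //; by exists i.
  by right=> i /bS bi Wi; exact: (Wb i).
have h1 := club_choose id (fun b => (nW' b).1).
have h2 := club_choose id (fun b => (nW' b).2).
have [d [_ ld [d1 d2]]] := club_unbounded omega1_0 (clubI h1 h2).
have [g gd gP] := lW d ld.
have [i [gi Wi] id] := d1 _ gd; have [j [gj nWj] jd] := d2 _ gd.
by apply: nWj; apply/gP; [rewrite gj|apply/(gP i); rewrite ?gi].
Qed.

End adapted_sets.

(** * Unboundedness along the edges, and its homotopy invariance *)

Section edges.
Context (R : realType) (s : omega1 -> arrow) (phi : omega1 -> longray R -> longray R).
Context (hphi : diagonal_segments s phi).
Local Notation LR := (longray R).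
Local Notation ord := (of_omega1 R).
Local Notation M := (surface s phi).
Local Notation pt := (pt hphi).
Local Notation bot := (@bot R s).
Implicit Types (x y z : LR) (b d i j mu lambda : omega1) (c : octant R) (U : set M).

(* The edge of index [i] is the bottom edge of the copy [i], hence the top edge of
   its predecessor. *)
Definition hor_index i := if s i is Up then i else omega1_S i.
Definition diag_index i := if s i is Up then omega1_S i else i.

Lemma pt_horizontal i x :
  pt i (oct x (ord omega1_0)) = pt (hor_index i) (bot (hor_index i) x).
Proof.
rewrite /hor_index; case si: (s i); first by rewrite bot_up.
apply: pt_glue; [|exact: bot_edge|by rewrite bot_rad].
by rewrite /top_edge si /=; exact/oct_hgt/r0_le.
Qed.

Lemma pt_diagonal i x : pt i (oct x x) = pt (diag_index i) (bot (diag_index i) x).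
Proof.
rewrite /diag_index; case si: (s i); last by rewrite bot_down.
apply: pt_glue; [|exact: bot_edge|by rewrite bot_rad].
by rewrite /top_edge si /=; exact: oct_hgt.
Qed.

Section edges_of_a_map.
Context (f : M -> LR) (cf : continuous f).

Definition edge i x := f (pt i (bot i x)).

Lemma edge_continuous i : continuous (edge i).
Proof.
by move=> x; exact: (cvg_comp _ _ (@pt_bot_continuous R s phi hphi i x) (@cf _)).
Qed.

Lemma copy_continuous i : continuous (f \o pt i).
Proof. by move=> c; exact: (cvg_comp _ _ (@pt_continuous R s phi hphi i c) (@cf _)). Qed.

Lemma edge_low i x : x <= ord i -> edge i x = edge omega1_0 x.
Proof. by move=> xi; rewrite /edge pt_low. Qed.

Lemma edge_limit lambda x (O : set LR) : limit_ordinal lambda -> ord lambda <= x ->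
  open O -> O (edge lambda x) ->
  exists2 mu, mu < lambda & forall i, mu <= i -> i < lambda -> O (edge i x).
Proof.
move=> ll lx oO Ox; have oU : open (f @^-1` O) by apply: open_comp => // p _; exact: cf.
have [mu [a [b [mul axb abU]]]] := open_edge_nbhd oU ll lx Ox.
by exists mu => // i mui il; apply: abU => //; rewrite bot_rad.
Qed.

Lemma edge_limit_lt lambda x y : limit_ordinal lambda -> ord lambda <= x ->
  edge lambda x < y ->
  exists2 mu, mu < lambda & forall i, mu <= i -> i < lambda -> edge i x < y.
Proof.
by move=> ll lx; apply: (edge_limit ll lx (O := [set z | z < y])); apply: open_lt (@id_continuous LR).
Qed.

Lemma edge_limit_gt lambda x y : limit_ordinal lambda -> ord lambda <= x ->
  y < edge lambda x ->
  exists2 mu, mu < lambda & forall i, mu <= i -> i < lambda -> y < edge i x.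
Proof.
by move=> ll lx; apply: (edge_limit ll lx (O := [set z | y < z])); apply: open_gt (@id_continuous LR).
Qed.

Let W i := unbounded (edge i).

Lemma unbounded_hor_diag i : W (hor_index i) -> W (diag_index i).
Proof.
have := horizontal_diagonal_unbounded (@copy_continuous i).
rewrite /W /edge; under eq_fun do rewrite /= pt_horizontal.
by under [X in _ -> unbounded X]eq_fun do rewrite /= pt_diagonal.
Qed.

Let W_prec i j : W i -> prec s i j -> W j.
Proof.
move=> + ij; elim: ij => [{}i {}j|//|x y z _ xy _ yz /xy/yz//].
by case=> -[si ->]; [have := @unbounded_hor_diag i|have := @unbounded_hor_diag j];
  rewrite /hor_index /diag_index si.
Qed.

(** A single radius [x] and a single level [ord B] decide membership in [W] for all [i <= lambda]:
    bounded edges stay below [ord B], unbounded ones have passed it at [x]. Continuity at the point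
    of radius [x] of the limit edge concludes. *)
Let W_limit lambda : limit_ordinal lambda -> exists2 mu, mu < lambda &
  forall i, mu <= i < lambda -> (W i <-> W lambda).
Proof.
move=> ll.
have /choice[N NP] : forall i, exists N, ~ W i -> forall x, edge i x < ord N.
  move=> i; have [Wi|Wi] := pselect (W i); first by exists omega1_0.
  by have [N NP] := not_unboundedP Wi; exists N.
have [B BP] := omega1_image_ubound N lambda.
have /choice[K KP] : forall i, exists K, W i -> forall x, ord K <= x -> ord B < edge i x.
  move=> i; have [Wi|Wi] := pselect (W i); last by exists omega1_0.
  by have [K KP] := unbounded_cofinal (@edge_continuous i) Wi B; exists K.
have [C CP] := omega1_image_ubound K lambda.
pose x := ord (Order.max C lambda).
have lx : ord lambda <= x by rewrite ord_le le_max lexx orbT.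
have up i : i <= lambda -> (ord B < edge i x <-> W i).
  move=> il; split=> [Bi|/KP]; last first.
    by apply; rewrite ord_le le_max ltW// CP.
  apply: contrapT => /NP/(_ x); rewrite ltNge => /negP; apply.
  by rewrite ltW// (lt_trans _ Bi)// ord_lt BP.
have [Wl|nWl] := pselect (W lambda).
  have [mu mul muP] := edge_limit_gt ll lx ((up _ (lexx lambda)).2 Wl).
  exists mu => // i /andP[mui il]; split => // _; apply/up; first exact: ltW.
  exact: muP.
have : edge lambda x < ord B.
  by rewrite (lt_trans (NP _ nWl x))// ord_lt BP.
move=> /(edge_limit_lt ll lx)[mu mul muP].
exists mu => // i /andP[mui il]; split => // /(up _ (ltW il)).2.
by move=> /lt_trans /(_ (muP _ mui il)); rewrite ltxx.
Qed.

(** The bottom edge of copy [d] meets the diagonal at radius [ord d]. For suitable [d], the edges of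
    large index [i < d] have value at least [ord d] there; so has their limit, which is a value on
    [Delta_0]. *)
Let W_zero : (exists beta, forall i, beta <= i -> W i) -> W omega1_0.
Proof.
move=> [beta Wb] b.
have : club (fun d => forall i, i < d -> W i -> forall x, (ord d <= edge i x) = (ord d <= x)).
  apply: club_diag => i; have [Wi|Wi] := pselect (W i); last by apply: club_all.
  by apply: clubW (unbounded_club (@edge_continuous i) Wi).
move=> /(club_unbounded (Order.max b beta))[d []]; rewrite gt_max => /andP[bd betad] ld dP.
exists (ord d); rewrite -(edge_low (i := d))//.
apply: (@le_trans _ _ (ord d)); first by rewrite ord_le ltW.
rewrite leNgt; apply/negP => /(edge_limit_lt ld (lexx _))[mu mud muP].
have md : Order.max mu beta < d by rewrite gt_max mud.
have := muP _ _ md; rewrite le_max lexx => /(_ isT).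
rewrite ltNge dP ?lexx// => //.
by apply: Wb; rewrite le_max lexx orbT.
Qed.

Lemma edges_adapted : adapted s W.
Proof. by split. Qed.

End edges_of_a_map.

Lemma unbounded_setP (f : M -> LR) : unbounded_set f = [set i | unbounded (edge f i)].
Proof. by apply/seteqP; split => i /unbounded_setE; apply. Qed.

Lemma unbounded_set_adapted (f : M -> LR) : continuous f -> adapted s (unbounded_set f).
Proof. by move=> cf; rewrite unbounded_setP; exact: edges_adapted. Qed.

Let clip (t : R) : R := Num.max 0%R (Num.min t 1%R).

Let clip01 (t : R) : (0 <= clip t <= 1)%R.
Proof. by rewrite /clip le_max lexx /= ge_max ler01 ge_min lexx orbT. Qed.

Let clip_continuous : continuous clip.
Proof.
apply: (@max_fun_continuous _ R R (fun=> 0%R) (fun t => Num.min t 1%R)).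
  by move=> t; exact: cvg_cst.
apply: (@min_fun_continuous _ R R id (fun=> 1%R)) => t; last exact: cvg_cst.
exact: cvg_id.
Qed.

Lemma homotopic_unbounded (H : M * R -> LR) (u v : R) i :
  {within [set: M] `*` `[0%R, 1%R], continuous H} ->
  (u = 0%R /\ v = 1%R) \/ (u = 1%R /\ v = 0%R) ->
  unbounded (edge (fun p => H (p, u)) i) -> unbounded (edge (fun p => H (p, v)) i).
Proof.
move=> cH uv.
(* [H] is controlled only for times in [[0, 1]], whereas [unbounded_deform] needs a family indexed
   by all reals; clipping provides it, in either direction of time. *)
pose q (t : R) : R := clip (u + t * (v - u))%R.
have cq : continuous q.
  have cl : continuous (fun t : R => u + t * (v - u))%R.
    move=> t; apply: cvgD; first exact: cvg_cst.
    by apply: cvgM; [exact: cvg_id|exact: cvg_cst].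
  by move=> t; exact: (cvg_comp _ _ (cl t) (@clip_continuous _)).
have q0 : q 0%R = u.
  rewrite /q mul0r addr0 /clip; case: uv => -[-> _]; first by rewrite min_l ?max_l.
  by rewrite min_l// max_r.
have q1 : q 1%R = v.
  rewrite /q mul1r addrC subrK /clip; case: uv => -[_ ->]; last by rewrite min_l ?max_l.
  by rewrite min_l// max_r.
pose h (t : R) x := H (pt i (bot i x), q t).
have cpb := @pt_bot_continuous R s phi hphi i.
rewrite -[X in edge (fun p => H (p, X)) i]q0 -[X in _ -> unbounded (edge (fun p => H (p, X)) i)]q1.
apply: (unbounded_deform (h := h)) => [t|x].
  apply: (within_comp_continuous (h := fun x => (pt i (bot i x), q t)) cH).
    exact: (pair_continuous cpb (@constant_continuous LR R (q t))).
  by move=> x; split => //=; rewrite in_itv /=; exact: clip01.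
apply: (within_comp_continuous (h := fun t => (pt i (bot i x), q t)) cH).
  exact: (pair_continuous (@constant_continuous R M (pt i (bot i x))) cq).
by move=> t; split => //=; rewrite in_itv /=; exact: clip01.
Qed.

Lemma homotopic_unbounded_set (f g : M -> LR) : homotopic R f g ->
  unbounded_set f = unbounded_set g.
Proof.
move=> [H [cH H0 H1]]; rewrite !unbounded_setP.
have -> : f = (fun p => H (p, 0%R)) by apply/funext => p; rewrite H0.
have -> : g = (fun p => H (p, 1%R)) by apply/funext => p; rewrite H1.
by apply/seteqP; split => i /=; apply: homotopic_unbounded => //; [left|right].
Qed.

End edges.

(** * Homotopies *)

Section common_level.
Context (R : realType) (s : omega1 -> arrow) (phi : omega1 -> longray R -> longray R).
Context (hphi : diagonal_segments s phi).
Local Notation LR := (longray R).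
Local Notation ord := (of_omega1 R).
Local Notation M := (surface s phi).
Local Notation pt := (pt hphi).
Local Notation bot := (@bot R s).
Local Notation edge := (edge hphi).
Implicit Types (x y z : LR) (b d i j mu lambda : omega1) (c : octant R) (U : set M) (p : M).

Lemma segment_bottom_radius i c : omega1_0 < i -> bottom_edge s i c ->
  segment phi i c -> oct_radius c = ord i.
Proof.
move=> i0 bc sc; have [P [cP PJ pP [_ sP] [bP _ _]]] := segment_coordinate_exists hphi i.
rewrite -(sP i0 _ sc) bP//; exact: (piece_radius hphi (segment_piece s sc)).
Qed.

(* [L] consists of the points lying in a copy of index [< d], among which are those
   of [Delta_0], that is, those of the segments. *)
Lemma low_set_exists d : limit_ordinal d -> exists L : set M, forall i c,
  L (pt i c) <-> [\/ i < d, segment phi i c | ~ piece s phi i c].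
Proof.
move=> ld.
have [||L LE] := @surface_descent R s phi hphi Prop
  (fun i c => [\/ i < d, segment phi i c | ~ piece s phi i c]); first last.
- by exists L => i c; rewrite LE.
- move=> i c nc; apply: propext; split=> _; first exact: Or31 (limit_gt0 ld).
  by case: nc; [exact: Or32|exact: Or33].
move=> i c c' tc bc' rcc'; apply: propext.
have Sd : (omega1_S i < d) = (i < d).
  apply/idP/idP => [/(lt_trans _)|]; last by case: ld => _; exact.
  by apply; exact: succ_gt.
case: (piece_top hphi tc bc' rcc') => -[h1 h2].
- split=> -[h|h|//]; [by apply: Or31; rewrite Sd|apply: Or32|by apply: Or31; rewrite -Sd|apply: Or32].
    by apply: (segment_low hphi h2); rewrite -rcc'; have [/andP[]] := h.
  apply: (segment_top hphi tc); rewrite rcc'; apply: segment_bottom_radius bc' h.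
  by rewrite lt_succP zero_le.
- by split=> _; [exact: Or33|exact: Or32].
- by split=> _; exact: Or33.
Qed.

Section level_sets.
Context (f : M -> LR) (cf : continuous f).
Let W : set omega1 := unbounded_set f.

(* The function whose large level sets on the copy [i] are those of [f]. *)
Definition level_coordinate (W : set omega1) i c : LR :=
  if pselect (W (hor_index s i)) then oct_radius c
  else if pselect (W (diag_index s i)) then oct_height c else ord omega1_0.

Lemma level_club : club (fun d => forall i, i < d -> forall c,
  (ord d <= f (pt i c)) = (ord d <= level_coordinate W i c)).
Proof.
apply: club_diag => i; have cG := @copy_continuous R s phi hphi f cf i.
have WE j : W j <-> unbounded (edge f j) by rewrite /W (unbounded_setP hphi).
have hE : (fun x => f (pt i (oct x (ord omega1_0)))) = edge f (hor_index s i).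
  by apply/funext => x; rewrite pt_horizontal.
have dE : (fun x => f (pt i (oct x x))) = edge f (diag_index s i).
  by apply/funext => x; rewrite pt_diagonal.
rewrite /level_coordinate; case: pselect => [Wh|nWh].
  by apply: (horizontal_unbounded_club cG); rewrite hE; exact/WE.
have nh : ~ unbounded (fun x => f (pt i (oct x (ord omega1_0)))) by rewrite hE => /WE.
case: pselect => [Wd|nWd].
  by apply: (diagonal_unbounded_club cG nh); rewrite dE; exact/WE.
have [|b bP] := diagonal_bounded cG; first by rewrite dE => /WE.
apply: clubW (club_gt b) => d ld bd c; rewrite ord_le [RHS]leNgt limit_gt0//.
by apply/negbTE; rewrite -ltNge (lt_trans (bP c))// ord_lt.
Qed.

(** The edge [d] is out of reach of the diagonal intersection over [i < d]; the inequality passes to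
    it as a limit of the edges of large index [i < d]. *)
Lemma edge_club_unbounded beta : (forall i, beta <= i -> W i) ->
  club (fun d => forall x, ord d <= x -> ord d <= edge f d x).
Proof.
move=> Wb.
have : club (fun d => forall i, i < d -> W i -> forall x, (ord d <= edge f i x) = (ord d <= x)).
  apply: club_diag => i; have [Wi|Wi] := pselect (W i); last by apply: club_all.
  move: (Wi); rewrite /W (unbounded_setP hphi) => ui.
  by apply: clubW (unbounded_club (edge_continuous cf (i := i)) ui).
move=> /(clubI (club_gt beta)); apply: clubW => d ld [bd dP] x dx.
rewrite leNgt; apply/negP => /(edge_limit_lt cf ld dx)[mu mud muP].
have md : Order.max mu beta < d by rewrite gt_max mud.
have := muP _ _ md; rewrite le_max lexx => /(_ isT).
rewrite ltNge dP ?dx// => //.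
by apply: Wb; rewrite le_max lexx orbT.
Qed.

(** Edges of large index [i < d] are constant from radius [ord d] on, hence so is their limit, the
    edge [d]; its constant is read off at radius [ord d], where it meets the diagonal. *)
Lemma edge_club_bounded beta : (forall i, beta <= i -> ~ W i) ->
  club (fun d => forall x, ord d <= x -> edge f d x = edge f omega1_0 (ord d)).
Proof.
move=> Wb.
have : club (fun d => forall i, i < d -> beta <= i -> forall x y,
    ord d <= x -> ord d <= y -> edge f i x = edge f i y).
  apply: club_diag => i; have [bi|ib] := leP beta i; last by apply: club_all.
  have := Wb _ bi; rewrite /W (unbounded_setP hphi) => ui.
  have [N NP] := bounded_eventually_constant (edge_continuous cf (i := i)) ui.
  apply: clubW (club_gt N) => d _ Nd _ x y dx dy.
  by apply: NP; rewrite (le_trans _ dx, le_trans _ dy)// ord_le ltW.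
move=> /(clubI (club_gt beta)); apply: clubW => d ld [bd dP] x dx.
rewrite -(edge_low hphi f (lexx (ord d))).
have key y z : ord d <= y -> ord d <= z -> ~ (edge f d y < edge f d z).
  move=> dy dz /lr_dense[u /andP[yu uz]].
  have [mu mud muP] := edge_limit_lt cf ld dy yu.
  have [nu nud nuP] := edge_limit_gt cf ld dz uz.
  pose i := Order.max beta (Order.max mu nu).
  have id : i < d by rewrite !gt_max bd mud.
  have mui : mu <= i by rewrite !le_max lexx !orbT.
  have nui : nu <= i by rewrite !le_max lexx !orbT.
  have := lt_trans (muP _ mui id) (nuP _ nui id).
  by rewrite (dP _ id _ y z)// ?ltxx// le_max lexx.
case: (ltgtP (edge f d x) (edge f d (ord d))) => // /key h.
  by case: (h dx (lexx _)).
by case: (h (lexx _) dx).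
Qed.

End level_sets.

Context (f g : M -> LR) (cf : continuous f) (cg : continuous g).
Context (W : set omega1) (fW : unbounded_set f = W) (gW : unbounded_set g = W).
Context (fg0 : W omega1_0 \/ forall x, edge f omega1_0 x = edge g omega1_0 x).

(** The levels at which a cut is clopen in the set where [f] and [g] differ. The conditions concern
    the copies before the cut, the edge [d] on which these accumulate, and [Delta_0], which runs
    through both sides. *)
Let good d := [/\ forall i, i < d -> forall c, (ord d <= f (pt i c)) = (ord d <= g (pt i c)),
  forall x, ord d <= x -> edge f d x <> edge g d x ->
    ord d <= edge f d x /\ ord d <= edge g d x &
  W omega1_0 -> forall x, (ord d <= edge f omega1_0 x) = (ord d <= x)].

Let good_club : club good.
Proof.
have c1 : club (fun d => forall i, i < d -> forall c,
    (ord d <= f (pt i c)) = (ord d <= g (pt i c))).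
  apply: clubW (clubI (level_club cf) (level_club cg)) => d _ [fd gd] i id c.
  by rewrite fd// gd// fW gW.
have c0 h : continuous h -> unbounded_set h = W ->
    club (fun d => W omega1_0 -> forall x, (ord d <= edge h omega1_0 x) = (ord d <= x)).
  move=> ch hW; have [W0|W0] := pselect (W omega1_0); last by apply: club_all.
  have : unbounded (edge h omega1_0) by move: W0; rewrite -hW (unbounded_setP hphi).
  by move=> /(unbounded_club (edge_continuous ch (i := _))); apply: clubW.
have c2 : club (fun d => forall x, ord d <= x -> edge f d x <> edge g d x ->
    ord d <= edge f d x /\ ord d <= edge g d x).
  have aW : adapted s W by rewrite -fW; exact: (unbounded_set_adapted hphi cf).
  have [beta _ [Wb|nWb]] := adapted_eventually_constant aW.
    have cbf := edge_club_unbounded cf (beta := beta); rewrite fW in cbf.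
    have cbg := edge_club_unbounded cg (beta := beta); rewrite gW in cbg.
    apply: clubW (clubI (cbf Wb) (cbg Wb)) => d _ [fd gd] x dx _.
    by split; [exact: fd|exact: gd].
  have cbf := edge_club_bounded cf (beta := beta); rewrite fW in cbf.
  have cbg := edge_club_bounded cg (beta := beta); rewrite gW in cbg.
  apply: clubW (clubI (clubI (c0 _ cf fW) (c0 _ cg gW)) (clubI (cbf nWb) (cbg nWb))).
  move=> d ld [[f0 g0] [fd gd]] x dx; rewrite fd// gd//.
  (* Both edges are constant here, with the values of [f] and [g] at radius [ord d] on [Delta_0].
     These coincide: either both are [ord d], or [f] and [g] agree on [Delta_0]. *)
  case: fg0 => [W0|->//].
  rewrite (unbounded_fixpoint (edge_continuous cf (i := _)) ld (f0 W0)).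
  by rewrite (unbounded_fixpoint (edge_continuous cg (i := _)) ld (g0 W0)).
by apply: clubW (clubI c1 (clubI c2 (c0 _ cf fW))) => d _ [h1 [h2 h3]]; split.
Qed.

Let E : set M := [set p | f p <> g p].

Let E_open : open E.
Proof. exact: open_neq. Qed.

Section cut.
Context (d : omega1) (ld : limit_ordinal d) (gd : good d) (L : set M).
Context (LE : forall i c, L (pt i c) <-> [\/ i < d, segment phi i c | ~ piece s phi i c]).

Let under : set M := [set p | f p < ord d] `&` [set p | g p < ord d].
Let over : set M := E `&` ([set p | ord d < f p] `|` [set p | ord d < g p]).

Let under_open : open under.
Proof. by apply: openI; exact: open_lt. Qed.

Let over_open : open over.
Proof. by apply: openI => //; apply: openU; exact: open_gt. Qed.

Let not_under_over p : under p -> ~ over p.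
Proof. by move=> [/ltW h1 /ltW h2] [_ []] /=; rewrite ltNge ?h1 ?h2. Qed.

Let rep p : L p -> exists2 i, i < d & exists c, p = pt i c.
Proof.
have [i [c [pc ->]]] := pt_surj hphi p.
move=> /LE[id|sc|//]; first by exists i => //; exists c.
by exists omega1_0; [exact: limit_gt0|exists (bot omega1_0 (oct_radius c)); exact: pt_diag].
Qed.

(** On [L] the maps reach [ord d] simultaneously, and where they differ they cannot both equal it.
    The closed condition of not being [under] thus becomes the open condition [over]. *)
Let under_or_over p : L p -> E p -> ~ under p -> over p.
Proof.
move=> /rep[i id [c ->]] Ep nu; split => //.
have [h _ _] := gd; have {h}hE := h i id c.
have [df|fd] := leP (ord d) (f (pt i c)); last first.
  have gd' : g (pt i c) < ord d by rewrite ltNge -hE -ltNge.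
  by case: nu; split.
have dg : ord d <= g (pt i c) by rewrite -hE.
have [/eqP|nf] := eqVneq (f (pt i c)) (ord d); last by left; rewrite /= lt_neqAle eq_sym nf.
by right; rewrite /= lt_neqAle dg andbT; apply/eqP => dE; apply: Ep; rewrite -dE; exact/eqP.
Qed.

Let on_Delta0 x : E (pt omega1_0 (bot omega1_0 x)) ->
  (ord d <= f (pt omega1_0 (bot omega1_0 x))) = (ord d <= x) /\
  (ord d <= g (pt omega1_0 (bot omega1_0 x))) = (ord d <= x).
Proof.
move=> Ex; case: fg0 => [W0|/(_ x) //]; have [h _ /(_ W0) h0] := gd.
by rewrite -h ?limit_gt0//; split; exact: h0.
Qed.

(** In a copy of index [>= d] the points of [L] come from [Delta_0], where being below level [ord d]
    means having radius below [ord d], an open condition on the whole copy. *)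
Let high_copy i c : d <= i -> E (pt i c) ->
  (L (pt i c) /\ under (pt i c)) <-> (under (pt i c) /\ oct_radius c < ord d).
Proof.
move=> di Ec; split=> [[Lc uc]|[uc cd]]; last first.
  split => //; apply/LE; apply: Or33 => /(piece_radius hphi).
  by rewrite leNgt (lt_le_trans cd)// ord_le.
split => //; have cE : pt i c = pt omega1_0 (bot omega1_0 (oct_radius c)).
  by move/LE: Lc => [|sc|nc]; [rewrite ltNge di|exact: pt_diag|exact: pt_out].
have := (on_Delta0 (x := oct_radius c)); rewrite -cE => /(_ Ec)[h _].
by rewrite ltNge -h -ltNge; case: uc.
Qed.

Let high_copy_over i c : d <= i -> E (pt i c) ->
  ~ (L (pt i c) /\ under (pt i c)) <-> (ord d < oct_radius c \/ over (pt i c)).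
Proof.
move=> di Ec; rewrite (high_copy di Ec); split; last first.
  case=> [dc [_ /lt_trans/(_ dc)]|oc [uc _]]; first by rewrite ltxx.
  exact: not_under_over uc oc.
move=> nuc; have [|cd] := ltP (ord d) (oct_radius c); [by left|right].
have cE : pt i c = pt omega1_0 (bot omega1_0 (oct_radius c)).
  have [pc|/pt_out//] := pselect (piece s phi i c).
  apply: pt_diag; apply: (segment_low hphi pc).
  by rewrite (le_trans cd)// ord_le.
apply: under_or_over => //; first by rewrite cE; apply/LE/Or31/limit_gt0.
move=> uc; apply: nuc; split => //.
have := (on_Delta0 (x := oct_radius c)); rewrite -cE => /(_ Ec)[h _].
by rewrite ltNge -h -ltNge; case: uc.
Qed.

Lemma open_below_cut : open (E `&` (L `&` under)).
Proof.
have oU : open (E `&` under) by exact: openI.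
apply: (surface_open (hphi := hphi)) => [i|lambda x ll lx [Ex [Lx ux]]].
  have [id|di] := ltP i d.
    rewrite (_ : _ @^-1` _ = pt i @^-1` (E `&` under)); first exact: open_pt.
    apply/seteqP; split => c /= [Ec]; first by case.
    by move=> uc; split => //; split => //; apply/LE/Or31.
  rewrite (_ : _ @^-1` _ = pt i @^-1` (E `&` under) `&` [set c | oct_radius c < ord d]).
    apply: openI; first exact: open_pt.
    by apply: open_lt; exact: radius_continuous.
  apply/seteqP; split => c /=.
    by move=> [Ec /(high_copy di Ec)[? ?]].
  by move=> [[Ec uc] cd]; split => //; apply/high_copy.
have [ld'|dl] := ltP lambda d; last first.
  have [_] := (high_copy dl Ex).1 (conj Lx ux).
  by rewrite bot_rad ltNge (le_trans _ lx)// ord_le.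
have [mu [a [b [mul axb abU]]]] := open_edge_nbhd oU ll lx (conj Ex ux).
exists mu, a, b; split => // i mui il c acb; have [Ec uc] := abU i mui il c acb.
by split => //; split => //; apply/LE/Or31/(lt_trans il).
Qed.

Lemma open_above_cut : open (E `\` (L `&` under)).
Proof.
have over_sub p : over p -> (E `\` (L `&` under)) p.
  by move=> op; split; [case: op|move=> [_ /not_under_over]; exact].
apply: (surface_open (hphi := hphi)) => [i|lambda x ll lx [Ex nx]].
  have [id|di] := ltP i d.
    rewrite (_ : _ @^-1` _ = pt i @^-1` over); first exact: open_pt.
    apply/seteqP; split => c /=; last exact: over_sub.
    move=> [Ec nc]; have Lc : L (pt i c) by apply/LE/Or31.
    by apply: under_or_over => // uc; exact: nc.
  rewrite (_ : _ @^-1` _ = pt i @^-1` E `&` ([set c | ord d < oct_radius c] `|` pt i @^-1` over)).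
    apply: openI; first exact: open_pt.
    by apply: openU; [apply: open_gt; exact: radius_continuous|exact: open_pt].
  apply/seteqP; split => c /=.
    by move=> [Ec nc]; split => //; apply/(high_copy_over di Ec).
  by move=> [Ec nc]; split => //; apply/(high_copy_over di Ec).
(* Beyond the cut, radius greater than [ord d] already excludes a point. On the edge [d] itself the
   second condition of [good] makes the point [over], and this spreads to the copies before the
   cut. *)
have [dl|ld'] := ltP d lambda.
  have [mu [a [b [mul /andP[ax xb] abU]]]] := open_edge_nbhd E_open ll lx Ex.
  exists (Order.max mu d), (Order.max a (ord d)), b; split.
  - by rewrite gt_max mul.
  - by rewrite gt_max ax (lt_le_trans _ lx) ?ord_lt.
  move=> i; rewrite ge_max => /andP[mui di] il c; rewrite gt_max => /andP[/andP[ac dc] cb].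
  have Ec : E (pt i c) by apply: (abU i) => //; rewrite ac.
  by split => //; apply/(high_copy_over di Ec); left.
have ox : over (pt lambda (bot lambda x)).
  have [dE|nd] := eqVneq lambda d.
    have [_ h _] := gd; have := h x; rewrite -dE => /(_ lx Ex)[h1 h2].
    split => //; have [/eqP fE|nf] := eqVneq (f (pt lambda (bot lambda x))) (ord d); last first.
      by left; rewrite /= lt_neqAle eq_sym nf -dE.
    right; rewrite /= lt_neqAle -dE h2 andbT; apply/eqP => gE; apply: Ex.
    by rewrite (eqP fE) -dE.
  have Lx : L (pt lambda (bot lambda x)) by apply/LE/Or31; rewrite lt_neqAle nd.
  by apply: under_or_over => // ux; exact: nx.
have [mu [a [b [mul axb abU]]]] := open_edge_nbhd over_open ll lx ox.
by exists mu, a, b; split => // i mui il c acb; apply/over_sub/abU.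
Qed.

End cut.

(* [m p] is the least [d] in a closed unbounded set of good levels such that [p] lies
   in a copy of index [< d] and [f p, g p < d]. On the set where [f] and [g] differ,
   this condition on [p] is open by [open_below_cut] and closed by
   [open_above_cut]. *)
Lemma common_bound : exists m : M -> omega1,
  (forall p, f p < ord (m p) /\ g p < ord (m p)) /\
  forall p, f p <> g p -> \forall q \near p, m q = m p.
Proof.
have [N NP] := good_club.
have /choice[L LE] : forall d, exists L : set M, limit_ordinal d -> forall i c,
    L (pt i c) <-> [\/ i < d, segment phi i c | ~ piece s phi i c].
  move=> d; have [ld|nld] := pselect (limit_ordinal d); last by exists setT.
  by have [L LE] := low_set_exists ld; exists L.
pose A d := L d `&` ([set p | f p < ord d] `&` [set p | g p < ord d]).
pose D d := closed_under N d.
have A_mono d d' p : D d -> D d' -> d <= d' -> A d p -> A d' p.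
  move=> [ld _] [ld' _] dd' [Ld [fd gd]]; split; last first.
    by split; [apply: lt_le_trans fd _|apply: lt_le_trans gd _]; rewrite ord_le.
  have [i [c [_ pE]]] := pt_surj hphi p; move: Ld; rewrite pE => /(LE d ld) h.
  apply/(LE d' ld'); case: h => [id|sc|nc]; [|exact: Or32|exact: Or33].
  by apply: Or31; exact: lt_le_trans dd'.
(* The inequalities defining [A d p] are strict, so at a limit [d] they already hold from some
   smaller ordinal on; hence [m p] is never a limit of smaller levels. *)
have small p d : limit_ordinal d -> A d p -> exists2 b, b < d &
    forall d', D d' -> b < d' -> A d' p.
  move=> ld [Ld [fd gd]].
  have [i id [c pE]] : exists2 i, i < d & exists c, p = pt i c.
    have [i [c [pc pE]]] := pt_surj hphi p; move: Ld; rewrite pE => /(LE d ld)[id|sc|//].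
      by exists i => //; exists c.
    exists omega1_0; first exact: limit_gt0.
    by exists (bot omega1_0 (oct_radius c)); exact: pt_diag.
  have [b1 b1d fb1] := lt_limit ld fd; have [b2 b2d gb2] := lt_limit ld gd.
  exists (Order.max i (Order.max b1 b2)); first by rewrite !gt_max id b1d.
  move=> d' [ld' _]; rewrite !gt_max => /andP[id' /andP[b1d' b2d']]; split.
    by rewrite pE; apply/(LE d' ld'); exact: Or31.
  by split; [apply: lt_trans fb1 _|apply: lt_trans gb2 _]; rewrite ord_lt.
have /choice[m mP] : forall p, exists d, (D d /\ A d p) /\
    forall d', D d' /\ A d' p -> d <= d'.
  move=> p.
  suff /omega1_least[d dP] : [set d | D d /\ A d p] !=set0 by exists d.
  have [i [c [pc pE]]] := pt_surj hphi p.
  pose b := Order.max i (Order.max (lr_index (f p)) (lr_index (g p))).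
  have [d bd Dd] := closed_under_unbounded N b; exists d; split => //.
  move: bd; rewrite !gt_max => /andP[id /andP[fd gd]]; split.
    by rewrite pE; apply/(LE d) => //; [case: Dd|exact: Or31].
  by split; rewrite /= lt_ord.
exists m; split=> [p|p Ep]; first by have [[_ [_ [h1 h2]]] _] := mP p.
have [[Dm Am] mmin] := mP p.
have near_below : \forall q \near p, m q <= m p.
  have [lm _] := Dm.
  have := open_nbhs_nbhs (conj (open_below_cut lm (NP _ Dm) (LE _ lm)) (conj Ep Am)).
  by apply: filterS => q [_ Aq]; have [_] := mP q; apply.
(* If [m p] is the first level, [m q <= m p] suffices. Otherwise the supremum [u] of the smaller
   levels is itself a level, and [u < m p] by [small]. Then [A u p] fails, hence [A u q] fails for
   [q] near [p], which forces [m q] above [u], so up to [m p]. *)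
pose B := [set d | D d /\ d < m p].
have [B0|/nonemptyPn B0] := pselect (B !=set0); last first.
  apply: filterS near_below => q; rewrite le_eqVlt => /orP[/eqP//|qm].
  have : B (m q) by split => //; have [[]] := mP q.
  by rewrite B0.
have ub0 : [set u | forall b, B b -> b <= u] !=set0 by exists (m p) => b [_ /ltW].
have [u [uB ulub]] := omega1_least ub0.
have ub b : b < u -> exists2 b', B b' & b < b'.
  move=> bu; apply: contrapT => nb; move: bu; rewrite ltNge => /negP; apply.
  apply: ulub => b' Bb'; rewrite leNgt; apply/negP => bb'; apply: nb.
  by exists b'.
have um : u <= m p by apply: ulub => b [_ /ltW].
have Du : D u by apply: (closed_under_lub B0) => // b [].
have {}um : u < m p.
  rewrite lt_neqAle um andbT; apply/eqP => uE.
  have [lm _] := Dm; have [b bm bP] := small p (m p) lm Am.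
  rewrite -uE in bm; have [d' [Dd' d'm] bd'] := ub _ bm.
  by have := mmin d' (conj Dd' (bP _ Dd' bd')); rewrite leNgt d'm.
have nAu : ~ A u p by move=> Au; have := mmin u (conj Du Au); rewrite leNgt um.
have [lu _] := Du.
have near_above : \forall q \near p, ~ A u q.
  have := open_nbhs_nbhs (conj (open_above_cut lu (NP _ Du) (LE _ lu)) (conj Ep nAu)).
  by apply: filterS => q [].
apply: filterS2 near_below near_above => q qm nAq.
apply/eqP; rewrite eq_le qm leNgt; apply/negP => mqm; apply: nAq.
have [[Dq Aq] _] := mP q.
by apply: A_mono Aq => //; apply: uB.
Qed.

End common_level.

Lemma eq_near_continuous (R : realType) (T : topologicalType) (H K : T -> longray R) z :
  (\forall u \near z, H u = K u) -> {for z, continuous K} -> {for z, continuous H}.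
Proof.
move=> HK cK; have Hz := nbhs_singleton HK.
by apply: lr_continuous_at => y; rewrite Hz => h;
  [have := near_gt cK h|have := near_lt cK h]; apply: filterS2 HK => u -> .
Qed.

(** * Construction of the homotopy *)

Section homotopy_existence.
Context (R : realType) (s : omega1 -> arrow) (phi : omega1 -> longray R -> longray R).
Context (hphi : diagonal_segments s phi).
Local Notation LR := (longray R).
Local Notation ord := (of_omega1 R).
Local Notation M := (surface s phi).
Implicit Types (x y : LR) (b d i : omega1) (p : M) (f g : M -> LR).

Let near_fst (P : M -> Prop) (z : M * R) :
  (\forall p \near z.1, P p) -> \forall u \near z, P u.1.
Proof. by move=> nP; exact: (cvg_fst nP). Qed.

Let near_snd (P : R -> Prop) (z : M * R) :
  (\forall t \near z.2, P t) -> \forall u \near z, P u.2.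
Proof. by move=> nP; exact: (cvg_snd nP). Qed.

Let fst_continuous f : continuous f -> continuous (fun z : M * R => f z.1).
Proof. by move=> cf z U nU; exact: (near_fst (cf z.1 U nU)). Qed.

Let snd_continuous (h : R -> LR) (a b : R) : continuous h ->
  continuous (fun z : M * R => h (a + b * z.2)%R).
Proof.
move=> ch z U nU; have ca : continuous (fun t : R => a + b * t)%R.
  move=> t; apply: cvgD; first exact: cvg_cst.
  by apply: cvgM; [exact: cvg_cst|exact: cvg_id].
apply: (near_snd (P := fun t => U (h (a + b * t)%R))).
exact: (ca z.2 _ (ch _ _ nU)).
Qed.

Lemma max_edge_unbounded f b : unbounded_set (fun p => Order.max (f p) (ord b)) = unbounded_set f.
Proof.
rewrite !(unbounded_setP hphi); apply/seteqP; split => i u c.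
  have [x] := u (Order.max c (omega1_S b)); rewrite /edge le_max !ord_le ge_max succ_leP ltxx andbF orbF.
  by move=> h; exists x; apply: le_trans h; rewrite ord_le le_max lexx.
by have [x h] := u c; exists x; rewrite /edge le_max h.
Qed.

Lemma same_unbounded_set_homotopic f g : continuous f -> continuous g ->
  unbounded_set f = unbounded_set g -> homotopic R f g.
Proof.
move=> cf cg fg.
(* If [0] is not in [C(f)], [b0] bounds both maps on [Delta_0], so that [f'] and [g'] agree there,
   as [common_bound] demands. *)
have [b0 bP] : exists b, unbounded_set f omega1_0 \/
    forall x, edge hphi f omega1_0 x <= ord b /\ edge hphi g omega1_0 x <= ord b.
  have [W0|W0] := pselect (unbounded_set f omega1_0); first by exists omega1_0; left.
  have := W0; rewrite fg; move: W0; rewrite !(unbounded_setP hphi).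
  move=> /not_unboundedP[b bP] /not_unboundedP[c cP].
  exists (Order.max b c); right => x.
  split; [apply: ltW (lt_le_trans (bP x) _)|apply: ltW (lt_le_trans (cP x) _)];
    by rewrite ord_le le_max lexx ?orbT.
pose f' p := Order.max (f p) (ord b0); pose g' p := Order.max (g p) (ord b0).
have cf' : continuous f' by apply: (@max_fun_continuous _ M LR f (fun=> ord b0)) => //; exact: constant_continuous.
have cg' : continuous g' by apply: (@max_fun_continuous _ M LR g (fun=> ord b0)) => //; exact: constant_continuous.
have [|m [mfg m_near]] := common_bound (hphi := hphi) cf' cg' (W := unbounded_set f)
    (max_edge_unbounded f b0) (etrans (max_edge_unbounded g b0) (esym fg)).
  case: bP => [|bP]; [by left|right] => x; have [h1 h2] := bP x.
  by rewrite /edge /f' /g' !max_r.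
have fm p : f p <= ord (m p).
  by have [/ltW + _] := mfg p; apply: le_trans; rewrite le_max lexx.
have gm p : g p <= ord (m p).
  by have [_ /ltW] := mfg p; apply: le_trans; rewrite le_max lexx.
have /choice[ga gaP] : forall d, exists ga : R -> LR, [/\ continuous ga,
    forall t, (t <= 0)%R -> ga t = ord omega1_0 & forall t, (1 <= t)%R -> ga t = ord d].
  by move=> d; exact: lr_path.
have gac d := let: And3 h _ _ := gaP d in h.
have ga0 d := let: And3 _ h _ := gaP d in h.
have ga1 d := let: And3 _ _ h := gaP d in h.
(* While [B] keeps the values [>= b0], the cap on [g] rises from [0] to [m p] and then
   the cap on [f] sinks from [m p] to [0]. Where [f'] and [g'] agree, [H] is continuous
   because it is squeezed between them; elsewhere [m] is locally constant. *)
pose B (z : M * R) := Order.min (ga b0 (0 + 6 * z.2)%R) (ga b0 (6 + (- 6) * z.2)%R).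
pose K d (z : M * R) := Order.max (Order.min (f z.1) (ga d (4 + (- 6) * z.2)%R))
                                 (Order.min (g z.1) (ga d (- 2 + 6 * z.2)%R)).
pose H (z : M * R) := Order.max (K (m z.1) z) (B z).
have cB : continuous B.
  by apply: min_fun_continuous; apply: snd_continuous; exact: gac.
have cK d : continuous (K d).
  apply: max_fun_continuous; apply: min_fun_continuous.
  - exact: fst_continuous.
  - by apply: snd_continuous; exact: gac.
  - exact: fst_continuous.
  - by apply: snd_continuous; exact: gac.
(* The timetable is in sixths: [B] rises during [[0, 1/6]] and falls during [[5/6, 1]]; the cap on
   [g] rises during [[1/3, 1/2]] and that on [f] sinks during [[1/2, 2/3]]. The idle sixths ensure
   that [B] is still [ord b0] around the times when caps move. *)
have Kf p (t : R) : (t < 1/3)%R -> K (m p) (p, t) = f p.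
  move=> t3; rewrite /K /= (ga1 (m p)); last lra.
  rewrite ga0; last lra.
  by rewrite min_l ?fm// min_r ?r0_le// max_l// r0_le.
have Kg p (t : R) : (2/3 < t)%R -> K (m p) (p, t) = g p.
  move=> t3; rewrite /K /= ga0; last lra.
  rewrite (ga1 (m p)); last lra.
  by rewrite min_r ?r0_le// min_l ?gm// max_r// r0_le.
have KBf p (t : R) : (t <= 1/2)%R -> f p <= K (m p) (p, t).
  move=> t2; have h : (1 <= 4 + (- 6) * t)%R by lra.
  by rewrite /K /= le_max (ga1 (m p) _ h) (min_l (fm p)) lexx.
have KBg p (t : R) : (1/2 <= t)%R -> g p <= K (m p) (p, t).
  move=> t2; have h : (1 <= - 2 + 6 * t)%R by lra.
  by rewrite /K /= !le_max (ga1 (m p) _ h) (min_l (gm p)) lexx orbT.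
have KBu p (t : R) : K (m p) (p, t) <= Order.max (f p) (g p).
  by rewrite /K /= ge_max !le_max !ge_min !lexx !orbT.
have Bm p (t : R) : (1/6 < t < 5/6)%R -> B (p, t) = ord b0.
  move=> /andP[t1 t2]; have h1 : (1 <= 0 + 6 * t)%R by lra.
  have h2 : (1 <= 6 + (- 6) * t)%R by lra.
  by rewrite /B /= (ga1 b0 _ h1) (ga1 b0 _ h2) minxx.
have cH : continuous H.
  move=> z; have [t3|t3] := ltP z.2 (1/3)%R.
    apply: (eq_near_continuous (K := fun z => Order.max (f z.1) (B z))).
      have := near_snd (lt_nbhsl t3); apply: filterS => -[p t] /= tt.
      by rewrite /H /= Kf.
    by apply: max_fun_continuous => //; exact: fst_continuous.
  have [t3'|t3'] := ltP (2/3)%R z.2.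
    apply: (eq_near_continuous (K := fun z => Order.max (g z.1) (B z))).
      have := near_snd (lt_nbhsr t3'); apply: filterS => -[p t] /= tt.
      by rewrite /H /= Kg.
    by apply: max_fun_continuous => //; exact: fst_continuous.
  have near6 : \forall u \near z, (1/6 < u.2 < 5/6)%R.
    have h1 : \forall t \near z.2, (1/6 < t)%R by apply: lt_nbhsr; lra.
    have h2 : \forall t \near z.2, (t < 5/6)%R by apply: lt_nbhsl; lra.
    by apply: filterS2 (near_snd h1) (near_snd h2) => u /= -> ->.
  have z6 := nbhs_singleton near6.
  have [fg'|nfg] := pselect (f' z.1 = g' z.1); last first.
    apply: (eq_near_continuous (K := fun u => Order.max (K (m z.1) u) (B u))).
      by have := near_fst (m_near _ nfg); apply: filterS => u mu; rewrite /H mu.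
    by apply: max_fun_continuous.
  have up p (t : R) : (1/6 < t < 5/6)%R -> H (p, t) <= Order.max (f' p) (g' p).
    move=> t6; rewrite /H /= Bm// /f' /g' maxACA maxxx ge_max le_max KBu /=.
    by rewrite le_max lexx orbT.
  have dn p (t : R) : (1/6 < t < 5/6)%R -> Order.min (f' p) (g' p) <= H (p, t).
    move=> t6; rewrite /H /= Bm// ge_min /f' /g'.
    have bH : ord b0 <= Order.max (K (m p) (p, t)) (ord b0) by rewrite le_max lexx orbT.
    have [t2|t2] := leP t (1/2)%R; apply/orP; [left|right]; rewrite ge_max bH andbT.
      by apply: le_trans (KBf p t t2) _; rewrite [leRHS]maxC le_max lexx orbT.
    by apply: le_trans (KBg p t (ltW t2)) _; rewrite [leRHS]maxC le_max lexx orbT.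
  have Hz : H z = f' z.1.
    apply/eqP; rewrite eq_le; have := up z.1 _ z6; have := dn z.1 _ z6.
    by rewrite -surjective_pairing -fg' minxx maxxx => -> ->.
  apply: lr_continuous_at => y; rewrite Hz => h.
    have nf := near_fst (near_gt (cf' z.1) h).
    have h' : y < g' z.1 by rewrite -fg'.
    have ng := near_fst (near_gt (cg' z.1) h').
    apply: filterS3 near6 nf ng => -[p t] u6 u1 u2.
    by apply: lt_le_trans (dn p t u6); rewrite lt_min; apply/andP.
  have nf := near_fst (near_lt (cf' z.1) h).
  have h' : g' z.1 < y by rewrite -fg'.
  have ng := near_fst (near_lt (cg' z.1) h').
  apply: filterS3 near6 nf ng => -[p t] u6 u1 u2.
  by apply: le_lt_trans (up p t u6) _; rewrite gt_max; apply/andP.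
exists H; split.
- exact: continuous_subspaceT.
- move=> p; rewrite /H /= Kf; last lra.
  have h : (0 + 6 * 0 <= 0 :> R)%R by lra.
  by rewrite /B /= (ga0 b0 _ h) (min_l (r0_le _)) (max_l (r0_le _)).
- move=> p; rewrite /H /= Kg; last lra.
  have h : (6 + (- 6) * 1 <= 0 :> R)%R by lra.
  by rewrite /B /= (ga0 b0 _ h) (min_r (r0_le _)) (max_l (r0_le _)).
Qed.

End homotopy_existence.

(** * Realization of adapted sets *)

Section realization.
Context (R : realType) (s : omega1 -> arrow) (phi : omega1 -> longray R -> longray R).
Context (hphi : diagonal_segments s phi).
Context (W : set omega1) (aW : adapted s W).
Local Notation LR := (longray R).
Local Notation ord := (of_omega1 R).
Local Notation M := (surface s phi).
Local Notation bot := (@bot R s).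
Local Notation level := (@level_coordinate R s W).
Implicit Types (x y : LR) (b d i j mu lambda : omega1) (c : octant R).

(** The trace of [level] on the edge [j]. Both adjacent copies induce the same trace, which makes
    [level] compatible with the gluing. *)
Let edge_level j x : LR := if pselect (W j) then x else ord omega1_0.

Let edge_levelT j x : W j -> edge_level j x = x.
Proof. by rewrite /edge_level; case: pselect. Qed.

Let edge_levelF j x : ~ W j -> edge_level j x = ord omega1_0.
Proof. by rewrite /edge_level; case: pselect. Qed.

Let edge_level_le j x : edge_level j x <= x.
Proof.
by have [Wj|nWj] := pselect (W j); [rewrite edge_levelT|rewrite edge_levelF// r0_le].
Qed.

Let level_hor i c : W (hor_index s i) -> level i c = oct_radius c.
Proof. by rewrite /level_coordinate; case: pselect. Qed.

Let level_diag i c : ~ W (hor_index s i) -> W (diag_index s i) -> level i c = oct_height c.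
Proof. by rewrite /level_coordinate; case: pselect => // ?; case: pselect. Qed.

Let level_none i c : ~ W (hor_index s i) -> ~ W (diag_index s i) -> level i c = ord omega1_0.
Proof. by rewrite /level_coordinate; case: pselect => // ?; case: pselect. Qed.

Lemma level_le_radius i c : level i c <= oct_radius c.
Proof.
rewrite /level_coordinate; case: pselect => ? //; case: pselect => ?; last exact: r0_le.
exact: height_le_radius.
Qed.

Lemma level_continuous i : continuous (level i).
Proof.
rewrite /level_coordinate; case: pselect => ?; first exact: radius_continuous.
case: pselect => ?; first exact: height_continuous.
exact: constant_continuous.
Qed.

Let W_hor_diag i : W (hor_index s i) -> W (diag_index s i).
Proof.
have [h _ _] := aW; move=> Wh; apply: h Wh _; apply: rt_step.
by rewrite /hor_index /diag_index; case si: (s i); [left|right].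
Qed.

Lemma level_bottom i c : bottom_edge s i c -> level i c = edge_level i (oct_radius c).
Proof.
have := @W_hor_diag i; have := @level_hor i c; have := @level_diag i c.
have := @level_none i c; rewrite /bottom_edge /hor_index /diag_index.
case: (s i) => /= h0 h1 h2 Wi hc; have [Wa|Wa] := pselect (W i).
- by rewrite edge_levelT// h2.
- rewrite edge_levelF//; have [Wb|Wb] := pselect (W (omega1_S i)); last exact: h0.
  by rewrite h1.
- rewrite edge_levelT//; have [Wb|Wb] := pselect (W (omega1_S i)); first exact: h2.
  by rewrite h1.
- by rewrite edge_levelF// h0// => /Wi.
Qed.

Lemma level_top i c : top_edge s i c -> level i c = edge_level (omega1_S i) (oct_radius c).
Proof.
have := @W_hor_diag i; have := @level_hor i c; have := @level_diag i c.
have := @level_none i c; rewrite /top_edge /hor_index /diag_index.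
case: (s i) => /= h0 h1 h2 Wi hc; have [Wa|Wa] := pselect (W (omega1_S i)).
- rewrite edge_levelT//; have [Wb|Wb] := pselect (W i); first exact: h2.
  by rewrite h1.
- by rewrite edge_levelF// h0// => /Wi.
- by rewrite edge_levelT// h2.
- rewrite edge_levelF//; have [Wb|Wb] := pselect (W i); last exact: h0.
  by rewrite h1.
Qed.

Lemma realization : exists2 f : M -> LR, continuous f & unbounded_set f = W.
Proof.
have [_ Wlim W0] := aW.
have [beta beta0 Wbeta] := adapted_eventually_constant aW.
have /choice[P PP] := segment_coordinate_exists hphi.
have cP i : continuous (P i) by have [] := PP i.
have P_ge i c : ord i <= P i c by have [_ /(_ c)/andP[]] := PP i.
have P_le i c : P i c <= ord (omega1_S i) by have [_ /(_ c)/andP[]] := PP i.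
have pP i c : piece s phi i c <-> P i c <= oct_radius c by have [_ _ h _ _] := PP i.
have P_seg i c : omega1_0 < i -> segment phi i c -> P i c = oct_radius c.
  by move=> i0; have [_ _ _ [_ h] _] := PP i; exact: h.
have P_bot i c : bottom_edge s i c -> ord i <= oct_radius c -> P i c = ord i.
  by have [_ _ _ _ [h _ _]] := PP i; exact: h.
have P_top i c : omega1_0 < i -> top_edge s i c -> ord (omega1_S i) <= oct_radius c ->
    P i c = ord (omega1_S i).
  by move=> i0; have [_ _ _ _ [_ h _]] := PP i; exact: h.
(* If [W] contains [0] but nothing beyond [beta], the map has to be the radius on the
   diagonal and bounded on each copy [i >= beta]: there it is capped by [P i]. *)
pose flat i := [/\ W omega1_0, forall j, beta <= j -> ~ W j & beta <= i].
(* [P i] is the radius on the segment, so the cap is not felt on the diagonal beyond [beta]; yet it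
   keeps [G1 i] at most [ord (omega1_S i)] on the copy. *)
pose G1 i c := Order.min (Order.max (oct_radius c) (ord beta)) (P i c).
pose G2 i c := Order.max (level i c) (ord beta).
pose G i c := if pselect (flat i) then G1 i c else G2 i c.
have GE1 i c : flat i -> G i c = G1 i c by rewrite /G; case: pselect.
have GE2 i c : ~ flat i -> G i c = G2 i c by rewrite /G; case: pselect.
have flat_gt0 i : flat i -> omega1_0 < i by move=> [_ _]; exact: lt_le_trans.
have flat_out i c : flat i -> segment phi i c \/ ~ piece s phi i c ->
    G1 i c = Order.max (oct_radius c) (ord beta).
  move=> fi; have [_ _ bi] := fi; have bP := le_trans (_ : ord beta <= ord i) (P_ge i c).
  rewrite ord_le in bP; move=> h; rewrite /G1 min_l// ge_max (bP bi) andbT.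
  by case: h => [/P_seg ->//|/pP]; [exact: flat_gt0|move/negP; rewrite -ltNge => /ltW].
have G2_low i c : oct_radius c <= ord beta -> G2 i c = ord beta.
  by move=> cb; rewrite /G2 max_r// (le_trans (level_le_radius _ _)).
have G_glue i c c' : top_edge s i c -> bottom_edge s (omega1_S i) c' ->
    oct_radius c = oct_radius c' -> G i c = G (omega1_S i) c'.
  move=> tc bc' rcc'.
  have G2S : G2 i c = G2 (omega1_S i) c' by rewrite /G2 (level_top tc) (level_bottom bc') rcc'.
  have [fi|nfi] := pselect (flat i).
    have fS : flat (omega1_S i) by case: fi => ? ? bi; split => //; rewrite (le_trans bi)// ltW// succ_gt.
    rewrite !GE1//; case: (piece_top hphi tc bc' rcc') => -[h1 h2].
    - have rS : ord (omega1_S i) <= oct_radius c' := piece_radius hphi h2.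
      by rewrite /G1 rcc' (P_bot _ _ bc')// (P_top _ _ _ tc) ?rcc'//; exact: flat_gt0.
    - by rewrite !flat_out//; [rewrite rcc'|right|left].
    - by rewrite !flat_out//; [rewrite rcc'|right|right].
  (* Entry into the capped copies: if only [omega1_S i] is flat, it equals [beta], and both formulas
     give [ord beta] on the common edge. *)
  rewrite GE2//; have [fS|nfS] := pselect (flat (omega1_S i)); last by rewrite GE2.
  have [WW nW bS] := fS; have SE : omega1_S i = beta.
    apply/eqP; rewrite eq_le bS andbT succ_leP ltNge; apply/negP => bi.
    by apply: nfi; split.
  rewrite GE1// G2S /G2 (level_bottom bc') edge_levelF; last exact: nW.
  rewrite SE in bc'; rewrite max_r ?r0_le// /G1 SE.
  have [bc|cb] := leP (ord beta) (oct_radius c').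
    by rewrite (P_bot _ _ bc')// min_r.
  by rewrite min_l// P_ge.
have nflat0 : ~ flat omega1_0 by move=> [_ _]; rewrite leNgt beta0.
have G_out i c : segment phi i c \/ ~ piece s phi i c ->
    G i c = G omega1_0 (bot omega1_0 (oct_radius c)).
  move=> h; rewrite [RHS]GE2// /G2 (level_bottom (@bot_edge R s _ _)) bot_rad.
  have [fi|nfi] := pselect (flat i).
    by rewrite GE1// flat_out// edge_levelT//; case: fi.
  (* For [i < beta] the points concerned have radius at most [ord beta], where truncation from below
     makes both sides equal to [ord beta]. *)
  rewrite GE2//; have [bi|ib] := leP beta i; last first.
    have cb : oct_radius c <= ord beta.
      apply: (@le_trans _ _ (ord (omega1_S i))); last by rewrite ord_le succ_leP.
      case: h => [[/andP[]//]|nc]; rewrite leNgt; apply/negP => Sc; apply: nc; left; exact: ltW.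
    by rewrite G2_low// max_r// (le_trans (edge_level_le _ _)).
  have hi : beta <= hor_index s i by rewrite /hor_index; case: (s i) => //; rewrite (le_trans bi)// ltW// succ_gt.
  have di : beta <= diag_index s i by rewrite /diag_index; case: (s i) => //; rewrite (le_trans bi)// ltW// succ_gt.
  (* If [W] contains all large ordinals, the level is the radius on these copies, and on [Delta_0]
     by condition (iii). If it omits them, [i] not being flat excludes [0] from [W], and both sides
     equal [ord beta]. *)
  case: Wbeta => [Wb|nWb].
    rewrite /G2 level_hor ?edge_levelT//; last exact: Wb.
    by apply: W0; exists beta.
  have nW0 : ~ W omega1_0 by move=> WW; apply: nfi; split.
  by rewrite /G2 edge_levelF// level_none//; exact: nWb.
have [f fE] := surface_descent hphi G_glue G_out.
have cG i : continuous (G i).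
  rewrite /G; case: pselect => ?.
    apply: (@min_fun_continuous _ _ LR (fun c => Order.max (oct_radius c) (ord beta)) (P i)) => //.
    apply: (@max_fun_continuous _ _ LR (@oct_radius R) (fun=> ord beta)).
      exact: radius_continuous.
    exact: constant_continuous.
  apply: (@max_fun_continuous _ _ LR (level i) (fun=> ord beta)).
    exact: level_continuous.
  exact: constant_continuous.
exists f.
  apply: (surface_continuous (hphi := hphi)) => [i|lambda x O ll lx oO].
    by rewrite (_ : f \o _ = G i)//; apply/funext => c /=; rewrite fE.
  rewrite fE; have [mu1 mu1l mu1P] := Wlim _ ll.
  have x0 : ord omega1_0 < x by rewrite (lt_le_trans _ lx)// ord_lt limit_gt0.
  have [[fl bl]|nfl] := pselect (flat lambda /\ beta < lambda).
    rewrite GE1// /G1 bot_rad (P_bot _ _ (@bot_edge R s _ _)) ?bot_rad//.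
    rewrite min_r ?le_max ?lx// => Ol.
    (* In copies of index [i] slightly below [lambda], [P i] lies between [ord i] and
       [ord (omega1_S i)], hence just below [ord lambda], while the radius stays above [y]; so the
       values of [G1] lie in the one-sided neighborhood. *)
    have [|y yl yO] := nbhs_left (open_nbhs_nbhs (conj oO Ol)); first by rewrite ord_lt limit_gt0.
    have [b0 b0l yb0] := lt_limit ll yl; have [z xz] := radius_lt x.
    exists (Order.max beta b0), y, z; split.
    - by rewrite gt_max bl.
    - by rewrite xz (lt_le_trans yl).
    move=> i; rewrite ge_max => /andP[bi b0i] il c /andP[yc cz].
    rewrite /preimage /mkset fE GE1; last by case: fl.
    apply: yO; rewrite /G1 lt_min lt_max yc /=; apply/andP; split.
      by rewrite (lt_le_trans yb0)// (le_trans _ (P_ge i c))// ord_le.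
    by rewrite ge_min (le_trans (P_le i c)) ?orbT// ord_le succ_leP.
  have nf i : i < lambda -> ~ flat i.
    move=> il [h1 h2 h3]; apply: nfl; have bl := le_lt_trans h3 il.
    by split => //; split => //; exact: ltW.
  (* [lambda = beta] may be flat although no smaller index is; both formulas then give [ord beta] on
     this edge. *)
  have -> : G lambda (bot lambda x) = Order.max (edge_level lambda x) (ord beta).
    have [fl|nfl'] := pselect (flat lambda); last first.
      by rewrite GE2// /G2 (level_bottom (@bot_edge R s _ _)) bot_rad.
    have [_ nW bl] := fl; have lE : lambda = beta.
      by apply/eqP; rewrite eq_le bl andbT leNgt; apply/negP => h; apply: nfl.
    rewrite GE1// /G1 bot_rad (P_bot _ _ (@bot_edge R s _ _)) ?bot_rad//.
    rewrite edge_levelF; last exact: nW.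
    by rewrite min_r ?le_max ?lx// max_r ?r0_le// lE.
  have hW i : mu1 <= i -> i < lambda -> (W (hor_index s i) <-> W lambda) /\ (W (diag_index s i) <-> W lambda).
    move=> mui il; have [_ Sl] := ll; have {}Sl := Sl _ il.
    have muS : mu1 <= omega1_S i by rewrite (le_trans mui)// ltW// succ_gt.
    have a1 : W i <-> W lambda by apply: mu1P; rewrite mui.
    have a2 : W (omega1_S i) <-> W lambda by apply: mu1P; rewrite muS.
    by rewrite /hor_index /diag_index; case: (s i).
  have [Wl|nWl] := pselect (W lambda); [rewrite edge_levelT|rewrite edge_levelF] => // Ox.
    have ch : continuous (fun x => Order.max x (ord beta)).
      by apply: (@max_fun_continuous _ LR LR id (fun=> ord beta)); [exact: id_continuous|exact: constant_continuous].
    have [y [z [yxz yzO]]] := nbhs_both (ch x _ (open_nbhs_nbhs (conj oO Ox))) x0.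
    exists mu1, y, z; split => // i mui il c ycz.
    rewrite /preimage /mkset fE (GE2 _ _ (nf i il)) /G2.
    have [hh _] := hW i mui il; rewrite level_hor; last exact/hh.
    exact: (yzO _ ycz).
  have [z xz] := radius_lt x.
  exists mu1, (ord omega1_0), z; split => //; first by rewrite x0.
  move=> i mui il c _; rewrite /preimage /mkset fE (GE2 _ _ (nf i il)) /G2.
  have [hh hd] := hW i mui il.
  have nh : ~ W (hor_index s i) by move/hh.
  have nd : ~ W (diag_index s i) by move/hd.
  by rewrite (level_none _ nh nd).
rewrite (unbounded_setP hphi); apply/seteqP; split => i /=; last first.
  move=> Wi b; exists (ord b).
  rewrite /edge fE GE2; last by move=> [_ + bi] => /(_ _ bi).
  by rewrite /G2 (level_bottom (@bot_edge R s _ _)) bot_rad edge_levelT// le_max lexx.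
move=> ui; apply: contrapT => nWi.
have [x] := ui (Order.max (omega1_S (omega1_S i)) (omega1_S beta)).
rewrite leNgt => /negP; apply; rewrite /edge fE.
have [fi|nfi] := pselect (flat i).
  rewrite GE1// /G1; apply: (@le_lt_trans _ _ (ord (omega1_S i))).
    by rewrite ge_min P_le orbT.
  by rewrite ord_lt lt_max succ_gt.
rewrite GE2// /G2 (level_bottom (@bot_edge R s _ _)) edge_levelF// max_r ?r0_le//.
by rewrite ord_lt lt_max succ_gt orbT.
Qed.

End realization.

Theorem theorem1 (R : realType) (s : omega1 -> arrow)
    (phi : omega1 -> longray R -> longray R) (hphi : diagonal_segments s phi) :
  exists frakC : set (surface s phi -> longray R) -> set omega1,
    (forall f : surface s phi -> longray R, continuous f ->
       frakC (homotopy_class R f) = unbounded_set f) /\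
    set_bij (homotopy_classes R (surface s phi) (longray R))
            [set W | adapted s W]%classic frakC.
Proof.
have homotopicE (f g : surface s phi -> longray R) : continuous f -> continuous g ->
    homotopic R f g <-> unbounded_set f = unbounded_set g.
  move=> cf cg; split; first exact: (homotopic_unbounded_set hphi).
  exact: (same_unbounded_set_homotopic hphi).
(* A union over the class, all of whose members have the same set; no representative has to be
   chosen. *)
pose frakC (A : set (surface s phi -> longray R)) : set omega1 :=
  [set gamma | exists2 f, A f & unbounded_set f gamma].
have frakCE f : continuous f -> frakC (homotopy_class R f) = unbounded_set f.
  move=> cf; apply/seteqP; split => gamma.
    by move=> [g [cg /(homotopicE _ _ cf cg) ->]].
  by move=> fg; exists f => //; split => //; apply/homotopicE.
exists frakC; split => //; split.
- by move=> _ [f cf <-]; rewrite frakCE//; exact: (unbounded_set_adapted hphi).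
- move=> _ _ /set_mem[f cf <-] /set_mem[g cg <-]; rewrite !frakCE// => fg.
  apply/seteqP; split => h [ch /homotopicE h1]; split => //; apply/homotopicE => //.
    by rewrite -fg h1.
  by rewrite fg h1.
move=> W /= aW; have [f cf fW] := realization hphi aW.
by exists (homotopy_class R f); [exists f|rewrite frakCE].
Qed.
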